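(* Let $T$ be a theory in a countable relational signature. The following are equivalent: (1) $T$ is $\omega$-categorical; (2) every type in $S_n(T)$, for every $n$, is isolated; (3) $S_n(T)$ is finite for every $n\in\mathbb N$.
   Context: Logic of co-valuations: for $R\subseteq A\times B$, $[a]_R=\{b:aRb\}$; $R$ is co-bijective if every $b\in B$ is related to some $a$, and every $a\in A$ has some $b$ related to $a$ and to no other element of $A$. A context is a finite set of variables (from a fixed supply containing $*$). A co-valuation on $M$ in context $X$ is a co-bijective $v\subseteq X\times M$; $\mathrm{Val}(X,M)$ is the set of these; for $w\in\mathrm{Val}(Y,M)$, $\geq\in\mathrm{Val}(X,Y)$, $C_\geq(w)=\geq\circ w$ (relational composition) is a consolidation of $w$ ($w$ fragments it). Formulas in context $X$: $\bot$, $R(x_1,\dots,x_{a(R)})$ with $x_k\in X$, $\neg\phi$, $\phi\wedge\psi$, $\exists^{\mathrm{fr}}_\geq\phi$ ($\geq\in\mathrm{Val}(X,Y)$, $\phi$ in context $Y$). Sentences: context $\{*\}$; theory: set of sentences; a type $p(X)$ is a set of formulas in context $X$, complete if it contains $\phi$ or $\neg\phi$ for each $\phi(X)$. Proto-structure $(M,\{R^M\},V)$: $L$-structure with family $V$ of co-valuations on $M$ in contexts closed under consolidations by contexts; $V^X=V\cap\mathrm{Val}(X,M)$. For $v\in V^X$: $M\not\models_v\bot$; $M\models_vR(\bar x)$ iff some $a_k\in[x_k]_v$ satisfy $R^M(\bar a)$; Boolean cases usual; $M\models_v\exists^{\mathrm{fr}}_\geq\phi$ iff some $w\in V$ has $v=C_\geq(w)$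 and $M\models_w\phi$. Structure: additionally (I) any two members of $V$ are fragmented by a common member of $V$; (II) if $v\in V^X$ and $M\models_vR(\bar x)$ then there are $w\in V^Y$, $\bar y\in Y^{a(R)}$ with $[x_k]_v\supseteq[y_k]_w$ and $\bar a$ with $R^M(\bar a)$, each $a_k$ in $[y_k]_w$ and in no $[y]_w$, $y\neq y_k$. Model of $T$: structure satisfying the sentences of $T$ (via its admissible co-valuation in context $\{*\}$). $S_n(T)$: complete types in a fixed context $X$ of size $n$ realized (satisfied entirely by some admissible co-valuation) in models of $T$. A type $p(X)$ is isolated if some formula $\phi(X)$ realized in a model of $T$ satisfies: for all models $(M,V)$ of $T$ and $v\in V^X$, $M\models_v\phi$ implies $M\models_v\psi$ for all $\psi\in p$. Compact $\omega$-model: a model $(M,V)$ such that there is a compact $T_1$ topology on $M$ in which every $\{[x]_v:x\in X\}$ ($v\in V^X$) is an open cover, every open cover is refined by one of these, all $R^M$ are closed, and there is a sequence $(v_i)$ in $V$, each $v_i$ a consolidation of $v_{i+1}$, with every member of $V$ a consolidation of some $v_i$. Isomorphism of $(M,V)$, $(N,W)$: bijection $f:M\to N$ preserving each relation in both directions with $\{f[u]:u\in V\}=W$, $f[u]=\{(x,f(a)):(x,a)\in u\}$. $T$ is $\omega$-categorical if it has, up to isomorphism, only one compact $\omega$-model.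
   Formalization: T is assumed complete: it has a model, and each sentence or its negation holds in all models of T. Without this, (2) and (3) can hold while (1) fails, e.g. for an incomplete theory whose models have only trivial co-valuations. The equivalence of (2) and (3) is also stated only for complete T. *)

(* Defs.v *)
From HB Require Import structures.
From mathcomp Require Import all_boot finmap.
From mathcomp Require Import all_classical.
From mathcomp Require Import topology.

Set Implicit Arguments.
Unset Strict Implicit.
Unset Printing Implicit Defensive.

Local Open Scope classical_set_scope.

(* A relation between A and B is a function r : A -> set B, so that r a is
   the set [a]_r = {b | a r b}. *)

Definition cobijective (A B : Type) (r : A -> set B) : Prop :=
  (forall b, exists a, r a b) /\
  (forall a, exists b, r a b /\ forall a', r a' b -> a' = a).

Definition rcomp (A B C : Type) (r : A -> set B) (s : B -> set C) :
    A -> set C :=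
  fun a c => exists2 b, r a b & s b c.

(* The supply of variables is nat, with 0 in the role of the distinguished
   variable *.  A context X : {fset nat} coerces to the finite type of its
   elements. *)
Definition context : Type := {fset nat}.

Definition star : context := [fset 0%N]%fset.

Definition is_consolidation (M : Type) (X Y : context)
    (v : X -> set M) (w : Y -> set M) : Prop :=
  exists2 ge : X -> set Y, cobijective ge & v = rcomp ge w.

Record signature := Signature {
  symbol :> Type;
  arity : symbol -> nat }.

Inductive formula (L : signature) (X : context) : Type :=
| FBot
| FRel (R : L) (x : 'I_(arity R) -> X)
| FNeg (phi : formula L X)
| FAnd (phi psi : formula L X)
| FExFr (Y : context) (ge : X -> set Y) (_ : cobijective ge)
    (phi : formula L Y).

Arguments FBot {L X}.
Arguments FRel {L X} R x.

Definition sentence (L : signature) : Type := formula L star.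

(* adm X is the set V^X of admissible co-valuations in context X. *)
Record protoStructure (L : signature) := ProtoStructure {
  carrier :> Type;
  interp : forall R : L, set ('I_(arity R) -> carrier);
  adm : forall X : context, set (X -> set carrier);
  adm_cobijective : forall (X : context) (v : X -> set carrier),
    adm v -> cobijective v;
  adm_consolidation : forall (X Y : context) (v : X -> set carrier)
    (w : Y -> set carrier), adm w -> is_consolidation v w -> adm v }.

Arguments interp {L} p R.
Arguments adm {L} p X.

(* Meaningful for v in adm M X; this is preserved in the recursive calls. *)
Fixpoint sat (L : signature) (M : protoStructure L) (X : context)
    (phi : formula L X) : (X -> set M) -> Prop :=
  match phi with
  | FBot => fun _ => False
  | FRel R x => fun v =>
      exists2 a : 'I_(arity R) -> M, (forall k, v (x k) (a k)) & interp M R a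
  | FNeg psi => fun v => ~ sat psi v
  | FAnd psi chi => fun v => sat psi v /\ sat chi v
  | FExFr Y ge _ psi => fun v =>
      exists w : Y -> set M, [/\ adm M Y w, v = rcomp ge w & sat psi w]
  end.

Definition is_structure (L : signature) (M : protoStructure L) : Prop :=
  (forall (X Y : context) (u : X -> set M) (v : Y -> set M),
     adm M X u -> adm M Y v ->
     exists (Z : context) (w : Z -> set M),
       [/\ adm M Z w, is_consolidation u w & is_consolidation v w]) /\
  (forall (X : context) (v : X -> set M) (R : L) (x : 'I_(arity R) -> X),
     adm M X v -> sat (FRel R x) v ->
     exists (Y : context) (w : Y -> set M) (y : 'I_(arity R) -> Y)
            (a : 'I_(arity R) -> M),
       [/\ adm M Y w,
           (forall k, w (y k) `<=` v (x k)),
           interp M R a &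
           (forall k, w (y k) (a k) /\ forall z, w z (a k) -> z = y k)]).

(* A co-valuation in context star is the total relation, so the witness v
   below is unique when it exists. *)
Definition sat_sentence (L : signature) (M : protoStructure L)
    (phi : sentence L) : Prop :=
  exists2 v : star -> set M, adm M star v & sat phi v.

Definition is_model (L : signature) (T : set (sentence L))
    (M : protoStructure L) : Prop :=
  [/\ is_structure M,
      (exists v : star -> set M, adm M star v) &
      (forall phi, T phi -> sat_sentence M phi)].

Definition complete_theory (L : signature) (T : set (sentence L)) : Prop :=
  (exists M : protoStructure L, is_model T M) /\
  (forall phi : sentence L,
     (forall M : protoStructure L, is_model T M -> sat_sentence M phi) \/
     (forall M : protoStructure L, is_model T M -> sat_sentence M (FNeg phi))).

Definition complete_type (L : signature) (X : context)
    (p : set (formula L X)) : Prop :=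
  forall phi, p phi \/ p (FNeg phi).

Definition realized (L : signature) (T : set (sentence L)) (X : context)
    (p : set (formula L X)) : Prop :=
  exists (M : protoStructure L) (v : X -> set M),
    [/\ is_model T M, adm M X v & forall phi, p phi -> sat phi v].

Definition types (L : signature) (T : set (sentence L)) (X : context) :
    set (set (formula L X)) :=
  [set p | complete_type p /\ realized T p].

Definition isolated (L : signature) (T : set (sentence L)) (X : context)
    (p : set (formula L X)) : Prop :=
  exists2 phi : formula L X, realized T [set phi] &
    forall (M : protoStructure L) (v : X -> set M),
      is_model T M -> adm M X v -> sat phi v ->
      forall psi, p psi -> sat psi v.

Definition is_open_cover (S : topologicalType) (U : set (set S)) : Prop :=
  (forall A, U A -> open A) /\ \bigcup_(A in U) A = setT.

(* The topology is given by a topologicalType S whose carrier is M; the sets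
   [x]_v form range v, and the relations are closed in the product topology. *)
Definition has_compact_topology (L : signature) (M : protoStructure L) : Prop :=
  exists tau : Topological M,
    let S : topologicalType := Topological.Pack tau in
    [/\ compact [set: S], accessible_space S,
        (forall (X : context) (v : X -> set M),
           adm M X v -> @is_open_cover S (range v)),
        (forall U : set (set S), is_open_cover U ->
           exists (X : context) (v : X -> set M), adm M X v /\
             forall x, exists2 A, U A & v x `<=` A) &
        (forall R : L,
           @closed (prod_topology (fun _ : 'I_(arity R) => S)) (interp M R))].

Definition has_cofinal_sequence (L : signature) (M : protoStructure L) : Prop :=
  exists (X : nat -> context) (v : forall i, X i -> set M),
    [/\ (forall i, adm M (X i) (v i)),
        (forall i, is_consolidation (v i) (v i.+1)) &
        (forall (Y : context) (w : Y -> set M), adm M Y w ->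
           exists i, is_consolidation w (v i))].

Definition compact_omega_model (L : signature) (T : set (sentence L))
    (M : protoStructure L) : Prop :=
  [/\ is_model T M, has_compact_topology M & has_cofinal_sequence M].

Definition isomorphic (L : signature) (M N : protoStructure L) : Prop :=
  exists f : M -> N,
    [/\ bijective f,
        (forall (R : L) (a : 'I_(arity R) -> M),
           interp M R a <-> interp N R (fun k => f (a k))) &
        (forall X : context,
           [set (fun x : X => f @` u x) | u in adm M X] = adm N X)].

Definition omega_categorical (L : signature) (T : set (sentence L)) : Prop :=
  exists2 M : protoStructure L, compact_omega_model T M &
    forall N : protoStructure L, compact_omega_model T N -> isomorphic M N.

(* Main.v *)
(** Conditions are definable predicates on co-valuations.  Descending along a
    countable family of dense requirements gives a tower of contexts, each a
    fragmentation of the previous one, with a complete and witnessed truth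
    predicate.  Its points are the minimal up-closed families meeting every
    level; they form a compact T1 space on which the tower is a cofinal sequence
    of covers, and truth in that compact omega-model is generic truth.  A
    relation holding in the tower is realized by points because axiom (II) of
    structures provides a tuple of co-valuation members below which the
    relation persists in all fragmentations, and Koenig's lemma then applies.
    Consistency with each class of a decreasing sequence of classes of models
    yields compactness, hence that there are only finitely many types once all
    are isolated; the requirement that a non-isolated type fail everywhere is
    dense, which refutes omega-categoricity.  Conversely, when all types are
    isolated, a back-and-forth between the cofinal sequences of two compact
    omega-models makes them towers over the same contexts with the same types,
    and compactness matches their points. *)

From HB Require Import structures.
From mathcomp Require Import all_boot finmap.
From mathcomp Require Import all_classical.
From mathcomp Require Import topology.
Require Import Defs.

Set Implicit Arguments.
Unset Strict Implicit.
Unset Printing Implicit Defensive.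

Local Open Scope classical_set_scope.

(** Formulas are finite while fragmentations live in contexts of any size, so each statement about
    all fragmentations has to be reduced to finitely many contexts. Two facts do this. Variables
    that carry the same finite information can be merged, which bounds the size of the context. And
    each member of a co-bijective relation has a point of its own, so that a co-valuation can be
    cancelled on the right: an equation or inclusion between consolidations of one co-valuation is
    already one between the finite relations that define them. Hence substitution along a relation
    and persistence, neither of which is a syntactic operation, are definable, and the pigeonhole
    principle extends a condition in the same way at all stages. Truth is treated for predicates on
    co-valuations, so that pulling back along a relation is mere composition. *)

Definition rid (A : Type) : A -> set A := fun x y => x = y.

(** * Composition and cancellation of co-bijective relations *)

Section Relations.
Variables A B C D : Type.
Implicit Types (r : A -> set B) (s : B -> set C) (t : C -> set D).

Lemma rcompA r s t : rcomp (rcomp r s) t = rcomp r (rcomp s t).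
Proof.
apply/funext => a; apply/seteqP; split => d [].
  by move=> c [b rb sb] tc; exists b => //; exists c.
by move=> b rb [c sb tc]; exists c => //; exists b.
Qed.

Lemma rcomp_idl r : rcomp (@rid A) r = r.
Proof.
apply/funext => a; apply/seteqP; split => b; first by case=> _ <-.
by exists a.
Qed.

Lemma rcomp_idr r : rcomp r (@rid B) = r.
Proof.
apply/funext => a; apply/seteqP; split => b; first by case=> c rc <-.
by exists b.
Qed.

Lemma cobij_id : cobijective (@rid A).
Proof. by split=> a; exists a => //; split. Qed.

Lemma cobij_comp r s : cobijective r -> cobijective s -> cobijective (rcomp r s).
Proof.
move=> [r1 r2] [s1 s2]; split=> [c|a].
  by have [b sb] := s1 c; have [a ra] := r1 b; exists a, b.
have [b [rb rbu]] := r2 a; have [c [sc scu]] := s2 b.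
exists c; split; first by exists b.
by move=> a' [b' rb' /scu eb]; apply: rbu; rewrite -eb.
Qed.

(** A point private to [b] under [s] can be reached from [A] only through [b], so what the composite
    relates to that point is related to [b] by [r]. *)
Lemma cobij_left r s :
  cobijective (rcomp r s) -> cobijective s -> cobijective r.
Proof.
move=> [rs1 rs2] [_ s2]; split=> [b|a].
  have [c [sc scu]] := s2 b; have [a [b' rb' /scu eb]] := rs1 c.
  by exists a; rewrite -eb.
have [c [[b rb sb] cu]] := rs2 a.
by exists b; split=> // a' ra'; apply: cu; exists b.
Qed.

Lemma cobij_private s b : cobijective s ->
  exists2 c, s b c & forall b', s b' c -> b' = b.
Proof. by case=> _ /(_ b) [c []]; exists c. Qed.

(** The inclusion is tested at a point private to [b] under [s]. This carries inclusions between
    co-valuations of a structure back to relations between finite contexts. *)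
Lemma rcomp_sub (A' : Type) r (r' : A' -> set B) s a a' : cobijective s ->
  rcomp r s a `<=` rcomp r' s a' -> r a `<=` r' a'.
Proof.
move=> cs sub b rb; have [c sc cu] := cobij_private b cs.
by have [|b' rb' /cu eb] := sub c; [exists b | rewrite -eb].
Qed.

Lemma rcomp_cancel r r' s : cobijective s -> rcomp r s = rcomp r' s -> r = r'.
Proof.
move=> cs e; apply/funext => a; apply/seteqP; split;
  by apply: (rcomp_sub cs); rewrite e.
Qed.

End Relations.

Lemma ex_choice (T U : Type) (P : T -> U -> Prop) :
  (forall t, exists u, P t u) -> exists f, forall t, P t (f t).
Proof. by move=> /choice [f fP]; exists f. Qed.

(** * Definable predicates on co-valuations *)

Definition finitary (T : Type) : Prop :=
  exists (I : finType) (f : I -> T), forall t, exists i, f i = t.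

Lemma finitary_finType (I : finType) : finitary I.
Proof. by exists I, id => i; exists i. Qed.

Lemma finitary_pair (T U : Type) : finitary T -> finitary U -> finitary (T * U).
Proof.
move=> [I [f fS]] [J [g gS]].
exists (I * J)%type, (fun k => (f k.1, g k.2)) => -[t u].
by have [[i <-] [j <-]] := (fS t, gS u); exists (i, j).
Qed.

Lemma finitary_rel (I J : finType) : finitary (I -> set J).
Proof.
exists {ffun I * J -> bool},
  (fun (F : {ffun I * J -> bool}) i j => is_true (F (i, j))) => r.
exists [ffun k => `[< r k.1 k.2 >]]; apply/funext => i; apply/funext => j.
by rewrite ffunE /=; apply/propext; split=> /asboolP.
Qed.

Lemma finitary_fun (I J : finType) : finitary (I -> J).
Proof.
exists {ffun I -> J}, (fun (F : {ffun I -> J}) i => F i) => f.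
exists [ffun i => f i].
by apply/funext => i; rewrite ffunE.
Qed.

Lemma finitary_bound (I : finType) (P : I -> nat -> Prop) :
  (forall i m n, (m <= n)%N -> P i m -> P i n) ->
  (forall i, exists n, P i n) -> exists n, forall i, P i n.
Proof.
move=> Pmono /choice [f fP]; exists (\max_i f i) => i.
exact/(Pmono _ (f i))/fP/leq_bigmax.
Qed.

Section Definable.
Variable L : signature.

Definition predicate (X : context) :=
  forall M : protoStructure L, (X -> set M) -> Prop.

Definition definable (X : context) (P : predicate X) : Prop :=
  exists phi : formula L X, forall M : protoStructure L, is_structure M ->
    forall v : X -> set M, adm M X v -> (sat phi v <-> P M v).

Lemma definable_sat (X : context) (phi : formula L X) :
  definable (fun M v => sat phi v).
Proof. by exists phi. Qed.

Lemma eq_definable (X : context) (P Q : predicate X) :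
  (forall M : protoStructure L, is_structure M ->
    forall v : X -> set M, adm M X v -> (P M v <-> Q M v)) ->
  definable P -> definable Q.
Proof.
move=> PQ [phi phiP]; exists phi => M MS v av.
by rewrite (phiP M MS v av); exact: PQ.
Qed.

Lemma definable_not (X : context) (P : predicate X) :
  definable P -> definable (fun M v => ~ P M v).
Proof.
by move=> [phi phiP]; exists (FNeg phi) => M MS v av /=; rewrite phiP.
Qed.

Lemma definable_and (X : context) (P Q : predicate X) :
  definable P -> definable Q -> definable (fun M v => P M v /\ Q M v).
Proof.
move=> [phi phiP] [psi psiP]; exists (FAnd phi psi) => M MS v av /=.
by rewrite phiP // psiP.
Qed.

Lemma definable_cst (X : context) (P : Prop) :
  definable (fun M (v : X -> set M) => P).
Proof.
have [p|np] := pselect P; last by exists FBot.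
by exists (FNeg FBot) => M MS v av /=; split=> // _ [].
Qed.

Lemma definable_or (X : context) (P Q : predicate X) :
  definable P -> definable Q -> definable (fun M v => P M v \/ Q M v).
Proof.
move=> dP dQ; apply: (@eq_definable _ (fun M v => ~ (~ P M v /\ ~ Q M v))).
  move=> M _ v _; split=> [|[|]]; last 2 first.
  - by move=> p [].
  - by move=> q [].
  by move=> h; apply: contrapT => /not_orP.
by apply/definable_not/definable_and; apply/definable_not.
Qed.

Lemma definable_ex (X : context) (T : Type) (P : T -> predicate X) :
  finitary T -> (forall t, definable (P t)) ->
  definable (fun M v => exists t, P t M v).
Proof.
move=> [I [f fS]] dP.
have : definable (fun M v => exists2 i, i \in enum I & P (f i) M v).
  elim: (enum I) => [|i s IHs].
    apply: eq_definable (definable_cst _ False) => M _ v _.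
    by split=> // -[].
  apply: eq_definable (definable_or (dP (f i)) IHs) => M _ v _; split.
    case=> [p|[j js p]]; first by exists i => //; rewrite mem_head.
    by exists j => //; rewrite inE js orbT.
  case=> j; rewrite inE => /orP[/eqP -> p|js p]; first by left.
  by right; exists j.
apply: eq_definable => M _ v _; split; first by case=> i _; exists (f i).
by case=> t; have [i <-] := fS t => p; exists i => //; rewrite mem_enum.
Qed.

Lemma definable_all (X : context) (T : Type) (P : T -> predicate X) :
  finitary T -> (forall t, definable (P t)) ->
  definable (fun M v => forall t, P t M v).
Proof.
move=> fT dP.
apply: eq_definable
  (definable_not (definable_ex fT (fun t => definable_not (dP t)))).
move=> M _ v _; split=> [h t|h [t]]; last by apply.
by apply: contrapT => np; apply: h; exists t.
Qed.

Lemma definable_exfr (X Y : context) (ge : X -> set Y) (P : predicate Y) :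
  cobijective ge -> definable P ->
  definable (fun M v => exists w, [/\ adm M Y w, v = rcomp ge w & P M w]).
Proof.
move=> cge [phi phiP]; exists (FExFr cge phi) => M MS v av /=.
by split=> -[w [aw e p]]; exists w; split=> //; apply/phiP.
Qed.

(* Contexts contained in [0, n); every context is, up to renaming and merging
   of variables that a finite invariant does not separate, of this form. *)
Definition bctx (n : nat) (S : {set 'I_n}) : context :=
  [fset nat_of_ord i | i in S]%fset.

(** The new variables are the ranks of the values of [f], and [q] sends each to its fibre; the
    fibres are nonempty and disjoint, so [q] is co-bijective. *)
Lemma quotient (K : finType) (Z : context) (f : Z -> K) :
  exists (S : {set 'I_#|K|}) (q : bctx S -> set Z), cobijective q /\
    (forall z' z z1, q z' z -> (q z' z1 <-> f z1 = f z)).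
Proof.
pose S := [set enum_rank (f z) | z : Z]%SET.
pose q : bctx S -> set Z := fun z' z => fsval z' = enum_rank (f z) :> nat.
have inj z z1 : enum_rank (f z) = enum_rank (f z1) :> nat -> f z = f z1.
  by move=> /val_inj /enum_rank_inj.
exists S, q; split; last first.
  move=> z' z z1 qz; split=> [qz1|e]; first by apply: inj; rewrite -qz -qz1.
  by rewrite /q e.
split=> [z|z'].
  have zS : (enum_rank (f z) : nat) \in bctx S.
    by apply/imfsetP; exists (enum_rank (f z)) => //; apply: imset_f.
  by exists [` zS]%fset.
have /imfsetP [i /= iS e] := fsvalP z'.
have /imsetP [z _ ez] : i \in S by [].
exists z; split; first by rewrite /q e ez.
by move=> z1 h; apply: val_inj; rewrite /= h e ez.
Qed.

(** By invariance each [a x] is a union of blocks of [q], so it is recovered from the blocks that it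
    meets. *)
Lemma quotient_factor (X Z Z' : context) (a : X -> set Z) (q : Z' -> set Z) :
  cobijective a -> cobijective q ->
  (forall z' z z1 x, q z' z -> q z' z1 -> a x z -> a x z1) ->
  exists2 a' : X -> set Z', cobijective a' & a = rcomp a' q.
Proof.
move=> ca cq inv.
pose a' : X -> set Z' := fun x z' => exists2 z, q z' z & a x z.
have e : a = rcomp a' q.
  apply/funext => x; apply/seteqP; split=> z.
    by move=> axz; have [z' qz] := cq.1 z; exists z' => //; exists z.
  by case=> z' [z1 qz1 axz1] qz; exact: (inv z' z1).
by exists a' => //; apply: (@cobij_left _ _ _ a' q); rewrite -?e.
Qed.

Section Structure.
Variables (M : protoStructure L) (MS : is_structure M).

Lemma adm_rcomp (X Y : context) (h : X -> set Y) (v : Y -> set M) :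
  cobijective h -> adm M Y v -> adm M X (rcomp h v).
Proof. by move=> ch av; apply: (adm_consolidation av); exists h. Qed.

(** A variable of a common fragmentation matters only through its sets of ancestors in [X] and in
    [Y]. The contexts of amalgams therefore range over a finite type that depends on [X] and [Y]
    alone. *)
Definition amalgam_index (X Y : context) : Type :=
  {set 'I_#|{: {set X} * {set Y}}| }.

Lemma amalgam (X Y : context) (v : X -> set M) (w : Y -> set M) :
  adm M X v -> adm M Y w ->
  exists (S : amalgam_index X Y) (a : X -> set (bctx S)) (b : Y -> set (bctx S))
         (u : bctx S -> set M),
    [/\ cobijective a, cobijective b, adm M _ u, v = rcomp a u & w = rcomp b u].
Proof.
move=> av aw; have [Z [u [au [a ca ea] [b cb eb]]]] := MS.1 _ _ _ _ av aw.
pose f (z : Z) := ([set x : X | `[< a x z >]], [set y : Y | `[< b y z >]])%SET.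
have [S [q [cq qP]]] := quotient f.
have inv z' z z1 : q z' z -> q z' z1 ->
    (forall x, a x z -> a x z1) /\ (forall y, b y z -> b y z1).
  move=> qz /(qP _ _ _ qz) [/setP e1 /setP e2]; split=> t h.
    by move/(_ t): e1; rewrite !inE (asboolT h) => /asboolP.
  by move/(_ t): e2; rewrite !inE (asboolT h) => /asboolP.
have [a' ca' ea'] : exists2 a' : X -> set (bctx S), cobijective a' &
    a = rcomp a' q.
  by apply: quotient_factor => // z' z z1 x qz qz1; apply: (inv z' z z1 qz qz1).1.
have [b' cb' eb'] : exists2 b' : Y -> set (bctx S), cobijective b' &
    b = rcomp b' q.
  by apply: quotient_factor => // z' z z1 x qz qz1; apply: (inv z' z z1 qz qz1).2.
exists S, a', b', (rcomp q u).
by split=> //; rewrite ?ea ?eb ?ea' ?eb' ?rcompA //; exact: adm_rcomp.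
Qed.

End Structure.

(** An atom becomes a disjunction over choices of variables. A quantifier becomes one over the
    bounded amalgams of [X] with the quantified context, where the equation between co-valuations
    cancels to one between relations. *)
Lemma definable_subst (X Y : context) (h : Y -> set X) (P : predicate Y) :
  cobijective h -> definable P -> definable (fun M v => P M (rcomp h v)).
Proof.
move=> ch [phi phiP].
apply: (@eq_definable _ (fun M v => sat phi (rcomp h v))) => [M MS v av|].
  exact/phiP/adm_rcomp.
elim: phi X h ch {P phiP} => {Y} [Y|Y R x|Y phi IH|Y phi IHphi psi IHpsi
    |Y Z ge cge phi IH] X h ch /=.
- exact: (@definable_cst _).
- apply: (@eq_definable _ (fun M v => exists y : 'I_(arity R) -> X,
      (forall k, h (x k) (y k)) /\ sat (FRel R y) v)) => [M MS v av|].
    split=> [[y [hy [a va Ra]]]|[a va Ra]].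
      by exists a => // k; exists (y k).
    have [y yP] : exists y : 'I_(arity R) -> X,
        forall k, h (x k) (y k) /\ v (y k) (a k).
      by apply: (@ex_choice _ _ (fun k z => h (x k) z /\ v z (a k))) => k;
        have [y] := va k; exists y.
    by exists y; split=> [k|]; [have [] := yP k | exists a => // k; have [] := yP k].
  refine (definable_ex _ _) => [|y]; first exact: finitary_fun.
  apply: definable_and; [exact: (@definable_cst _) | exact (definable_sat _)].
- exact/definable_not/IH.
- by apply: definable_and; [apply: IHphi | apply: IHpsi].
- apply: (@eq_definable _ (fun M v => exists (S : amalgam_index X Z)
      (ab : (X -> set (bctx S)) * (Z -> set (bctx S))),
      [/\ cobijective ab.1, cobijective ab.2 & rcomp h ab.1 = rcomp ge ab.2] /\
      exists u, [/\ adm M _ u, v = rcomp ab.1 u & sat phi (rcomp ab.2 u)]))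
      => [M MS v av|].
    split.
      case=> S [[a b] /= [[ca cb e] [u [au ev su]]]].
      exists (rcomp b u); split=> //; first exact: adm_rcomp.
      by rewrite ev -!rcompA e.
    case=> w [aw e sw]; have [S [a [b [u [ca cb au ev ew]]]]] := amalgam MS av aw.
    exists S, (a, b); split=> /=; last by exists u; rewrite -ew.
    split=> //; apply: (rcomp_cancel (adm_cobijective au)).
    by rewrite !rcompA -ev -ew.
  refine (definable_ex _ _) => [|S]; first exact: finitary_finType.
  refine (definable_ex _ _) => [|[a b] /=].
    by apply: finitary_pair; exact: finitary_rel.
  have [[ca cb e]|nP] := pselect [/\ cobijective a, cobijective b &
      rcomp h a = rcomp ge b]; last first.
    by apply: eq_definable (definable_cst _ False) => M _ v _; split=> // -[].
  apply: eq_definable (definable_exfr ca (IH _ b cb)) => M _ v _.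
  by split=> [|[]].
Qed.

(* In a structure whose relations are closed, this says that R holds at a tuple
   of points each of which lies in the corresponding [v (y k)] only. *)
Definition persistent (Y : context) (R : L) (y : 'I_(arity R) -> Y) :
    predicate Y :=
  fun M v => forall (Z : context) (ge : Y -> set Z) (w : Z -> set M),
    cobijective ge -> adm M Z w -> v = rcomp ge w ->
    exists z : 'I_(arity R) -> Z,
      (forall k y', ge y' (z k) -> y' = y k) /\ sat (FRel R z) w.

(** A fragmentation that refutes persistence still does so after merging the variables with the same
    ancestors in [Y], so only finitely many contexts have to be excluded. *)
Lemma definable_persistent (Y : context) (R : L) (y : 'I_(arity R) -> Y) :
  definable (persistent y).
Proof.
apply: (@eq_definable _ (fun M v => forall (S : {set 'I_#|{: {set Y}}| })
    (ge : Y -> set (bctx S)), ~ (cobijective ge /\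
      exists w, [/\ adm M _ w, v = rcomp ge w &
       ~ exists z : 'I_(arity R) -> bctx S,
        (forall k y', ge y' (z k) -> y' = y k) /\ sat (FRel R z) w])))
    => [M MS v av|]; last first.
  refine (definable_all _ _) => [|S]; first exact: finitary_finType.
  refine (definable_all _ _) => [|ge]; first exact: finitary_rel.
  apply: definable_not.
  have [cge|ncge] := pselect (cobijective ge); last first.
    by apply: eq_definable (definable_cst _ False) => M _ v _; split=> // -[].
  apply: definable_and; first exact: (@definable_cst _).
  apply: definable_exfr => //; apply/definable_not; refine (definable_ex _ _) => [|z].
    exact: finitary_fun.
  by apply: definable_and; [exact: (@definable_cst _) | exact (definable_sat _)].
split=> [h Z ge w cge aw e|h S ge [cge [w [aw e []]]]]; last exact: h.
pose f (z : Z) := [set y : Y | `[< ge y z >]]%SET.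
have [S [q [cq qP]]] := quotient f.
have inv z' z z1 : q z' z -> q z' z1 -> forall y, ge y z -> ge y z1.
  move=> qz /(qP _ _ _ qz) /setP e1 y' g.
  by move/(_ y'): e1; rewrite !inE (asboolT g) => /asboolP.
have [ge' cge' ege] := quotient_factor cge cq
  (fun z' z z1 x qz qz1 => inv z' z z1 qz qz1 x).
have /not_andP[//|/forallNP /(_ (rcomp q w))] := h S ge'.
rewrite not_and3P => -[||/contrapT [z' [z'u [a za Ra]]]].
- by case; exact: adm_rcomp.
- by rewrite e ege rcompA.
have [z zP] : exists z : 'I_(arity R) -> Z,
    forall k, q (z' k) (z k) /\ w (z k) (a k).
  by apply: (@ex_choice _ _ (fun k z => q (z' k) z /\ w z (a k))) => k;
    have [z] := za k; exists z.
exists z; split; last by exists a => // k; have [] := zP k.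
move=> k y'; have [qz _] := zP k; rewrite ege => -[z1 g qz1].
(* All elements of a block have the same ancestors, so the element [t] private to [z' k] turns an
   ancestor of [z k] into one of [z' k]. *)
apply: (z'u k); have [t qt tu] := cobij_private (z' k) cq.
have : ge y' (z k) by rewrite ege; exists z1.
move=> /(inv _ _ _ qz qt); rewrite ege => -[t' g' qt'].
by rewrite -(tu t' qt').
Qed.

(** A fragment chosen to contain [a k] has all its ancestors among the members that contain [a k],
    and only [y k] can be one of these. *)
Lemma persistent_point (M : protoStructure L) (Y : context) (v : Y -> set M)
    (R : L) (y : 'I_(arity R) -> Y) (a : 'I_(arity R) -> M) :
  interp M R a -> (forall k y', v y' (a k) -> y' = y k) -> persistent y v.
Proof.
move=> Ra au Z ge w cge aw e.
have [z zP] : exists z : 'I_(arity R) -> Z, forall k, w (z k) (a k).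
  by apply: (@ex_choice _ _ (fun k z => w z (a k))) => k;
    exact: (adm_cobijective aw).1.
exists z; split; last by exists a.
by move=> k y' g; apply: au; rewrite e; exists (z k).
Qed.

End Definable.

(** * Towers of finite sets and their spectra *)

Section Tower.
Variables (X : nat -> finType) (ge : forall n, X n -> set (X n.+1)).
Arguments ge : clear implicits.

(* The equality of dependent pairs spares transporting [x] along [i = j]. *)
Fixpoint down (i j : nat) : X i -> set (X j) :=
  match j return X i -> set (X j) with
  | 0 => fun x y => Tagged X x = Tagged X y
  | j'.+1 => fun x y => Tagged X x = Tagged X y \/
      exists2 z : X j', @down i j' x z & ge j' z y
  end.
Arguments down : clear implicits.

Lemma down_leq i j (x : X i) (y : X j) : down i j x y -> (i <= j)%N.
Proof.
elim: j y => [|j IH] y /=.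
  by move=> /(congr1 (@tag _ _)) /= ->.
case=> [/(congr1 (@tag _ _)) /= -> //|[z /IH ij _]]; exact: leqW.
Qed.

Lemma down_refl i : down i i = @rid (X i).
Proof.
apply/funext => x; apply/seteqP; split=> y; last first.
  by rewrite /rid => <-; case: i x {y} => [|n] x //=; left.
have eqT (x1 y1 : X i) : Tagged X x1 = Tagged X y1 -> x1 = y1.
  exact: eq_from_Tagged.
suff H j (y1 : X j) : down i j x y1 -> j = i -> Tagged X x = Tagged X y1.
  by move=> /H /(_ erefl) /eqT.
case: j y1 => [//|j] y1 /= [//|[z /down_leq ij _] e].
by exfalso; move: ij; rewrite -e ltnn.
Qed.

Lemma downS i j : (i <= j)%N -> down i j.+1 = rcomp (down i j) (ge j).
Proof.
move=> ij; apply/funext => x; apply/seteqP; split=> y /=; last by right.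
case=> [/(congr1 (@tag _ _)) /= e|//].
by exfalso; move: ij; rewrite e ltnn.
Qed.

Lemma down_step i : down i i.+1 = ge i.
Proof. by rewrite downS // down_refl rcomp_idl. Qed.

Lemma down_trans i j k : (i <= j)%N -> (j <= k)%N ->
  rcomp (down i j) (down j k) = down i k.
Proof.
move=> ij; elim: k => [|k IH] jk.
  move: ij; have -> : j = 0 by apply/eqP; rewrite -leqn0.
  by rewrite leqn0 => /eqP ->; rewrite down_refl rcomp_idl.
move: jk; rewrite leq_eqVlt => /predU1P [ejk|jk].
  by subst j; rewrite down_refl rcomp_idr.
rewrite ltnS in jk.
by rewrite (downS jk) -rcompA IH // downS // (leq_trans ij).
Qed.

Lemma down_covaluation (T : Type) (v : forall n, X n -> set T) :
  (forall n, v n = rcomp (ge n) (v n.+1)) ->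
  forall i j, (i <= j)%N -> v i = rcomp (down i j) (v j).
Proof.
move=> vE i; elim=> [|j IH].
  by rewrite leqn0 => /eqP ->; rewrite down_refl rcomp_idl.
rewrite leq_eqVlt => /predU1P [->|]; first by rewrite down_refl rcomp_idl.
by rewrite ltnS => ij; rewrite downS // rcompA -vE IH.
Qed.

Definition upclosed (S : forall n, set (X n)) : Prop :=
  forall n x y, ge n x y -> S n.+1 y -> S n x.

Lemma upclosed_down (S : forall n, set (X n)) i j (x : X i) (y : X j) :
  upclosed S -> down i j x y -> S j y -> S i x.
Proof.
move=> Sup; elim: j y => [|j IH] y /=.
  by move=> /(congr1 (fun u : {n & X n} => S (tag u) (tagged u))) /= ->.
case=> [/(congr1 (fun u : {n & X n} => S (tag u) (tagged u))) /= -> //|].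
by case=> z /IH xz zy /(Sup _ _ _ zy).
Qed.

Definition selector (S : forall n, set (X n)) : Prop :=
  upclosed S /\ forall n, S n !=set0.

Definition minimal (S : forall n, set (X n)) : Prop :=
  selector S /\ forall S', selector S' -> (forall n, S' n `<=` S n) ->
    forall n, S n `<=` S' n.

Lemma minimal_exists B : selector B ->
  exists2 S, minimal S & forall n, S n `<=` B n.
Proof.
move=> selB.
pose T := {S | selector S /\ forall n, S n `<=` B n}.
pose R (S S' : T) := `[< forall n, sval S' n `<=` sval S n >].
have RP S S' : reflect (forall n, sval S' n `<=` sval S n) (R S S').
  exact: asboolP.
pose B0 : T := exist _ B (conj selB (fun _ _ h => h)).
have [|||[S [selS SB]] Smin] := @ZL_preorder T B0 R.
- by move=> S; apply/RP => n x.
- by move=> r s t /RP rs /RP st; apply/RP => n x /st /rs.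
- move=> A Atot; have [[S0 AS0]|A0] := pselect (exists S, A S); last first.
    by exists (exist _ B (conj selB (fun _ _ h => h))) => s As; case: A0; exists s.
  pose I n := [set x | forall S, A S -> sval S n x].
  suff selI : selector I /\ forall n, I n `<=` B n.
    by exists (exist _ I selI) => s As; apply/RP => n x /=; exact.
  split; last by move=> n x /(_ _ AS0); case: S0 AS0 => S0 /= [_ +] _; exact.
  split=> [n x y xy Iy S AS|n].
    by apply: (proj2_sig S).1.1 xy _; exact: Iy.
  (* Level [n] is finite, so some member of the chain has the fewest elements there; at that level
     it is contained in every other member, and the intersection is nonempty. *)
  pose P k := `[< exists2 S, A S & #|[set x | `[< sval S n x >]]%SET| = k >].
  have Pex : exists k, P k by exists #|[set x | `[< sval S0 n x >]]%SET|; apply/asboolP; exists S0.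
  case: (ex_minnP Pex) => k /asboolP [S1 AS1 <-] kmin.
  have [x S1x] := (proj2_sig S1).1.2 n; exists x => S AS.
  have [/RP S1S|/RP SS1] := Atot _ _ AS AS1; first exact: S1S.
  have sub : ([set x | `[< sval S n x >]] \subset [set x | `[< sval S1 n x >]])%SET.
    by apply/fintype.subsetP => z; rewrite !inE; exact: SS1.
  have /eqP/setP/(_ x) : ([set x | `[< sval S n x >]] == [set x | `[< sval S1 n x >]])%SET.
    by rewrite eqEcard sub /=; apply: kmin; apply/asboolP; exists S.
  by rewrite !inE (asboolT S1x) => /asboolP.
- exists S => //; split=> // S' selS' S'S.
  have S'B : selector S' /\ forall n, S' n `<=` B n.
    by split=> // n x /S'S /SB.
  pose u : T := exist _ S (conj selS SB); pose u' : T := exist _ S' S'B.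
  exact: (elimT (RP u' u) (Smin u' (introT (RP u u') S'S))).
Qed.

Hypothesis ge_above : forall n y, exists x, ge n x y.

Lemma down_above i j (y : X j) : (i <= j)%N -> exists x, down i j x y.
Proof.
elim: j y => [|j IH] y.
  by rewrite leqn0 => /eqP ->; exists y; rewrite down_refl.
rewrite leq_eqVlt => /predU1P [->|]; first by exists y; rewrite down_refl.
rewrite ltnS => ij; have [z zy] := ge_above y; have [x xz] := IH z ij.
by exists x; rewrite downS //; exists z.
Qed.

(** Otherwise the elements of [S] that are not below [x] would form a selector inside [S] that
    misses [x]. *)
Lemma minimal_focus S i (x : X i) : minimal S -> S i x ->
  exists2 j, (i <= j)%N & forall k y, (j <= k)%N -> S k y -> down i k x y.
Proof.
move=> [[Sup Sn0] Smin] Sx; apply: contrapT => nj.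
pose S' n := [set y | S n y /\ ~ down i n x y].
have : S' i x; last by case=> _; rewrite down_refl; apply.
apply: Smin Sx => [|n y []//]; split=> [n y z yz [Sz nz]|n].
  split; first exact: Sup yz Sz.
  move=> xy; apply: nz; rewrite downS; last exact: down_leq xy.
  by exists y.
apply: contrapT => S'0; apply: nj; exists (maxn i n); first exact: leq_maxl.
move=> k y mk Sy; apply: contrapT => nxy; apply: S'0.
have [z zy] := down_above y (leq_trans (leq_maxr i n) mk).
exists z; split; first exact: upclosed_down zy Sy.
move=> xz; apply: nxy.
rewrite -(@down_trans i n k) ?(down_leq xz) ?(down_leq zy) //.
by exists z.
Qed.

(** An element of [S] at a deep level lies below [x], and so does one of its ancestors at the next
    level. This makes each basic cover the consolidation of the following one. *)
Lemma minimal_spread S i (x : X i) : minimal S -> S i x ->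
  exists2 y, ge i x y & S i.+1 y.
Proof.
move=> mS Sx; have [j ij jP] := minimal_focus mS Sx.
have [y Sy] := mS.1.2 (maxn j i.+1).
have := jP _ y (leq_maxl _ _) Sy.
rewrite -(@down_trans i i.+1) ?leqnSn ?leq_maxr // down_step => -[z xz zy].
by exists z => //; exact: upclosed_down mS.1.1 zy Sy.
Qed.

Lemma minimal_base S i1 i2 (x1 : X i1) (x2 : X i2) :
  minimal S -> S i1 x1 -> S i2 x2 ->
  exists j y, [/\ S j y, down i1 j x1 y & down i2 j x2 y].
Proof.
move=> mS S1 S2; have [j1 _ jP1] := minimal_focus mS S1.
have [j2 _ jP2] := minimal_focus mS S2.
have [y Sy] := mS.1.2 (maxn j1 j2).
by exists (maxn j1 j2), y; split=> //; [apply: jP1 | apply: jP2];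
  rewrite ?leq_maxl ?leq_maxr.
Qed.

Definition spectrum : Type := {S | minimal S}.

Definition basic (i : nat) (x : X i) : set spectrum :=
  [set S | sval S i x].

Lemma basic_down i j (x : X i) (y : X j) : down i j x y -> basic y `<=` basic x.
Proof. by move=> xy S Sy; exact: upclosed_down (proj2_sig S).1.1 xy Sy. Qed.

Definition basic_open (U : set spectrum) : Prop :=
  forall S, U S -> exists i (x : X i), basic x S /\ basic x `<=` U.

Lemma basic_openT : basic_open setT.
Proof.
by move=> S _; have [x Sx] := (proj2_sig S).1.2 0; exists 0, x.
Qed.

Lemma basic_openI : setI_closed basic_open.
Proof.
move=> U V oU oV S [/oU [i [x [Sx xU]]] /oV [j [y [Sy yV]]]].
have [k [z [Sz xz yz]]] := minimal_base (proj2_sig S) Sx Sy.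
exists k, z; split=> // S' zS'.
by split; [apply/xU/(basic_down xz) | apply/yV/(basic_down yz)].
Qed.

Lemma basic_open_bigU (I : Type) (f : I -> set spectrum) :
  (forall i, basic_open (f i)) -> basic_open (\bigcup_i f i).
Proof.
move=> fo S [i _ /fo [k [x [Sx xf]]]]; exists k, x; split=> // S' /xf.
by exists i.
Qed.

HB.instance Definition _ := gen_eqMixin spectrum.
HB.instance Definition _ := gen_choiceMixin spectrum.
HB.instance Definition _ :=
  isOpenTopological.Build spectrum basic_openT basic_openI basic_open_bigU.

Definition spectrum_space : topologicalType := spectrum.

Lemma spectrum_openP (U : set spectrum_space) : open U <-> basic_open U.
Proof.
split=> [|oU].
  rewrite openE => oU S /oU [V [oV VS VU]].
  by have [i [x [Sx xV]]] := oV S VS; exists i, x; split=> // S' /xV /VU.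
by rewrite openE => S US; exists U; split=> // S'.
Qed.

Lemma basic_is_open i (x : X i) : open (basic x : set spectrum_space).
Proof. by apply/spectrum_openP => S Sx; exists i, x; split=> // S'. Qed.

Lemma spectrum_eq (S S' : spectrum) :
  (forall n, sval S n `<=` sval S' n) -> S = S'.
Proof.
case: S S' => [S mS] [S' mS'] /= sub; apply: eq_exist.
apply: functional_extensionality_dep => n.
by apply/seteqP; split; [exact: sub | exact: mS'.2 mS.1 sub n].
Qed.

(** Minimality makes distinct points incomparable, so each belongs to a basic set that misses the
    other. *)
Lemma spectrum_accessible : accessible_space spectrum_space.
Proof.
move=> S S' /eqP neq.
have [n [x [Sx S'x]]] : exists n (x : X n), sval S n x /\ ~ sval S' n x.
  apply: contrapT => h; apply: neq; apply: spectrum_eq => n x Sx.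
  by apply: contrapT => S'x; apply: h; exists n, x.
exists (basic x); split; first exact: basic_is_open.
  by rewrite inE.
by rewrite inE.
Qed.

Lemma spectrum_compact : compact [set: spectrum_space].
Proof.
move=> F FF _.
(* Any point inside [B] is a cluster point of [F]. If [B] were empty at level [n], each of the
   finitely many basic sets of that level would miss a member of [F], yet these sets cover the
   space. *)
pose B n := [set x : X n | forall A, F A -> basic x `&` A !=set0].
have selB : selector B.
  split=> [n x y xy By A /By [S [Sy AS]]|n].
    exists S; split=> //; apply: basic_down Sy.
    by rewrite down_step.
  apply: contrapT => B0.
  have /ex_choice [A AP] : forall x : X n, exists A, F A /\ ~ (basic x `&` A !=set0).
    move=> x; apply: contrapT => h; apply: B0; exists x => A FA.
    by apply: contrapT => hA; apply: h; exists A.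
  have /filter_ex [S SA] := filter_forall FF (fun x => (AP x).1).
  have [x Sx] := (proj2_sig S).1.2 n.
  by case: (AP x) => _; apply; exists S; split=> //; exact: SA.
have [S mS SB] := minimal_exists selB.
exists (exist _ S mS); split=> // A V FA.
rewrite nbhsE => -[U [/spectrum_openP oU US] UV].
have [i [x [Sx xU]]] := oU _ US.
have [S' [xS' AS']] := SB _ _ Sx A FA.
by exists S'; split=> //; exact/UV/xU.
Qed.

(** The elements whose basic set lies in no member of [U] would otherwise form a selector, and a
    point inside it would not be covered. *)
Lemma spectrum_cover_refined (U : set (set spectrum_space)) : is_open_cover U ->
  exists n, forall x : X n, exists2 A, U A & basic x `<=` A.
Proof.
move=> [Uo Ucov]; apply: contrapT => h.
pose B n := [set x : X n | ~ exists2 A, U A & basic x `<=` A].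
have selB : selector B.
  split=> [n x y xy By [A UA xA]|n].
    apply: By; exists A => // S Sy; apply/xA/(basic_down _ Sy).
    by rewrite down_step.
  by apply: contrapT => B0; apply: h; exists n => x; apply: contrapT => Bx;
    apply: B0; exists x.
have [S mS SB] := minimal_exists selB.
have [A UA AS] : (\bigcup_(A in U) A) (exist _ S mS) by rewrite Ucov.
have /spectrum_openP oA := Uo A UA.
have [i [x [Sx xA]]] := oA _ AS.
by apply: (SB _ _ Sx); exists A.
Qed.

Lemma basic_rcomp i : @basic i = rcomp (ge i) (@basic i.+1).
Proof.
apply/funext => x; apply/seteqP; split=> S.
  by move=> /(minimal_spread (proj2_sig S)) [y xy Sy]; exists y.
by case=> y xy Sy; exact: (proj2_sig S).1.1 xy Sy.
Qed.

Hypothesis ge_cobij : forall n, cobijective (ge n).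

Lemma down_cobij i j : (i <= j)%N -> cobijective (down i j).
Proof.
elim: j => [|j IH].
  by rewrite leqn0 => /eqP ->; rewrite down_refl; exact: cobij_id.
rewrite leq_eqVlt => /predU1P [->|].
  by rewrite down_refl; exact: cobij_id.
by rewrite ltnS => ij; rewrite downS //; apply: cobij_comp => //; exact: IH.
Qed.

Lemma basic_cobij i : cobijective (@basic i).
Proof.
split=> [S|x]; first exact: (proj2_sig S).1.2.
(* The condition is vacuous before level [i]; from there on it keeps the elements whose only
   ancestor at level [i] is [x]. A point inside [B] is private to [x]. *)
pose B n := [set z : X n | (i <= n)%N -> forall x', down i n x' z -> x' = x].
have selB : selector B.
  split=> [n y z yz Bz i_n x' x'y|n].
    by apply: Bz; [exact: leqW | rewrite downS //; exists y].
  have [i_n|n_i] := leqP i n; last first.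
    have [y yx] := down_above x (ltnW n_i).
    by exists y => i_n; move: n_i; rewrite ltnNge i_n.
  have [y xy yu] := cobij_private x (down_cobij i_n).
  by exists y => _.
have [S mS SB] := minimal_exists selB.
have Bi y : B i y -> y = x by move=> /(_ (leqnn i) y); apply; rewrite down_refl.
have Sx : S i x by have [y Sy] := mS.1.2 i; rewrite -(Bi y (SB _ _ Sy)).
by exists (exist _ S mS); split=> // x' /SB /Bi.
Qed.

End Tower.

(** * The compact structure of a generic tower *)

Section SpectralStructure.
Variables (L : signature) (X : nat -> context).
Variable ge : forall n, X n -> set (X n.+1).
Arguments ge : clear implicits.

Definition levels (n : nat) : finType := fset_sub_type (X n).
Definition dn (i j : nat) : X i -> set (X j) := @down levels ge i j.
Definition bas (i : nat) : X i -> set (@spectrum levels ge) :=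
  @basic levels ge i.
Arguments dn : clear implicits.
Arguments bas : clear implicits.

(* [tr i P] stands for: the generic co-valuation in context [X i] satisfies P. *)
Variable tr : forall i, predicate L (X i) -> Prop.

(** These are the closure properties of a Henkin construction: [gen_exfr] gives witnesses of
    quantifiers, [gen_rel] the strong witnesses behind axiom (II). Only predicates given by formulas
    are decided, whereas [gen_imp] admits every semantic consequence over structures. *)
Record generic : Prop := Generic {
  gen_cobij : forall n, cobijective (ge n);
  gen_imp : forall i (P Q : predicate L (X i)),
    (forall M : protoStructure L, is_structure M ->
      forall v, adm M (X i) v -> P M v -> Q M v) -> tr P -> tr Q;
  gen_and : forall i (P Q : predicate L (X i)),
    tr P -> tr Q -> tr (fun M v => P M v /\ Q M v);
  gen_consistent : forall i, ~ tr (fun M (v : X i -> set M) => False);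
  gen_down : forall i j (P : predicate L (X i)), (i <= j)%N ->
    tr P <-> tr (fun M v => P M (rcomp (dn i j) v));
  gen_decide : forall i (Y : context) (h : Y -> set (X i)) (phi : formula L Y),
    cobijective h -> tr (fun M v => sat phi (rcomp h v)) \/
      tr (fun M v => ~ sat phi (rcomp h v));
  gen_exfr : forall i (Y Z : context) (h : Y -> set (X i)) (r : Y -> set Z)
      (cr : cobijective r) (phi : formula L Z), cobijective h ->
    tr (fun M v => sat (FExFr cr phi) (rcomp h v)) ->
    exists j (g : Z -> set (X j)), [/\ (i <= j)%N, cobijective g,
      rcomp h (dn i j) = rcomp r g & tr (fun M v => sat phi (rcomp g v))];
  gen_rel : forall i (Y : context) (h : Y -> set (X i)) (R : L)
      (x : 'I_(arity R) -> Y), cobijective h ->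
    tr (fun M v => sat (FRel R x) (rcomp h v)) ->
    exists j (Y' : context) (g : Y' -> set (X j)) (y : 'I_(arity R) -> Y'),
      [/\ (i <= j)%N, cobijective g,
       (forall k, g (y k) `<=` rcomp h (dn i j) (x k)) &
       tr (fun M v => persistent y (rcomp g v))] }.

Hypothesis gen : generic.

Let ge_cobij := gen_cobij gen.

Let ge_above n (y : X n.+1) : exists x, ge n x y.
Proof. exact: (ge_cobij n).1. Qed.

Lemma tr_all i (I : finType) (P : I -> predicate L (X i)) :
  (forall t, tr (P t)) -> tr (fun M v => forall t, P t M v).
Proof.
move=> trP.
have : tr (fun M v => forall t, t \in enum I -> P t M v).
  elim: (enum I) => [|t s IH].
    (* The empty conjunction is true because [FBot] is decided and cannot be true. *)
    have [phi|nphi] := gen_decide gen FBot (@cobij_id (X i)).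
      by case: (gen_consistent gen (i := i)); apply: gen_imp phi.
    by apply: (gen_imp gen) nphi => M _ v _ _ t; rewrite in_nil.
  apply: (gen_imp gen) (gen_and gen (trP t) IH) => M _ v _ [Pt Ps] u.
  by rewrite inE => /predU1P [->//|/Ps].
by apply: (gen_imp gen) => M _ v _ h t; apply: h; rewrite mem_enum.
Qed.

Lemma tr_rel_mono i j (R : L) (y : 'I_(arity R) -> X i) (z : 'I_(arity R) -> X j) :
  (forall k, dn i j (y k) (z k)) -> (i <= j)%N ->
  tr (fun M v => sat (FRel R z) v) -> tr (fun M v => sat (FRel R y) v).
Proof.
move=> yz ij trz; apply/(gen_down gen _ ij); apply: (gen_imp gen) trz.
by move=> M _ v _ [a za Ra]; exists a => // k; exists (z k).
Qed.

(** Quantifying over all boxes around the tuple makes the relation closed by construction. *)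
Definition spectral_interp (R : L) :
    set ('I_(arity R) -> @spectrum levels ge) :=
  [set a | forall i (x : 'I_(arity R) -> X i),
    (forall k, sval (a k) i (x k)) -> tr (fun M v => sat (FRel R x) v)].

Definition spectral_adm (Y : context) : set (Y -> set (@spectrum levels ge)) :=
  [set v | exists i, is_consolidation v (bas i)].

Lemma spectral_adm_cobijective (Y : context)
    (v : Y -> set (@spectrum levels ge)) : spectral_adm v -> cobijective v.
Proof.
move=> [i [h ch ->]]; apply: cobij_comp => //.
exact: (@basic_cobij levels ge).
Qed.

Lemma spectral_adm_consolidation (Y Z : context)
    (v : Y -> set (@spectrum levels ge)) (w : Z -> set (@spectrum levels ge)) :
  spectral_adm w -> is_consolidation v w -> spectral_adm v.
Proof.
move=> [i [h ch ->]] [r cr ->]; exists i; exists (rcomp r h).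
  exact: cobij_comp.
by rewrite rcompA.
Qed.

Definition spectral : protoStructure L :=
  ProtoStructure spectral_interp spectral_adm_cobijective
    spectral_adm_consolidation.

Lemma bas_down i j : (i <= j)%N -> bas i = rcomp (dn i j) (bas j).
Proof.
apply: (@down_covaluation levels ge) => n.
exact: (@basic_rcomp levels ge).
Qed.

Lemma adm_bas i (Y : context) (h : Y -> set (X i)) :
  cobijective h -> adm spectral Y (rcomp h (bas i)).
Proof. by move=> ch; exists i; exists h. Qed.

Lemma adm_bas_id i : adm spectral (X i) (bas i).
Proof. by rewrite -[bas _]rcomp_idl; exact/adm_bas/cobij_id. Qed.

Let tuples (R : L) (n : nat) : finType := {ffun 'I_(arity R) -> X n}.
Let tuples_ge (R : L) (n : nat) : tuples R n -> set (tuples R n.+1) :=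
  fun z z' => forall k, ge n (z k) (z' k).

Lemma tuples_down (R : L) i j (z : tuples R i) (z' : tuples R j)
    (k : 'I_(arity R)) :
  @down _ (@tuples_ge R) i j z z' -> dn i j (z k) (z' k).
Proof.
elim: j z' => [|j IH] z' /=.
  by move=> /(congr1 (fun u : {n & tuples R n} =>
    Tagged levels (tagged u k))).
case; last by case=> u /IH zu uz'; right; exists (u k).
by move=> /(congr1 (fun u : {n & tuples R n} =>
    Tagged levels (tagged u k))) /= e; left.
Qed.

(* Koenig's lemma, applied to the tower of tuples: a minimal selector of the
   tuples at which R is true yields a tuple of points. *)
Lemma spectral_rel_points i (Y : context) (h : Y -> set (X i)) (R : L)
    (x : 'I_(arity R) -> Y) : cobijective h ->
  tr (fun M v => sat (FRel R x) (rcomp h v)) ->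
  exists j (Y' : context) (g : Y' -> set (X j)) (y : 'I_(arity R) -> Y')
         (a : 'I_(arity R) -> spectral),
    [/\ cobijective g, interp spectral R a,
     (forall k, rcomp g (bas j) (y k) `<=` rcomp h (bas i) (x k)) &
     (forall k, rcomp g (bas j) (y k) (a k) /\
        forall z, rcomp g (bas j) z (a k) -> z = y k)].
Proof.
move=> ch /(gen_rel gen ch) [j [Y' [g [y [ij cg gy trp]]]]].
(* Besides the truth of [R], from level [j] on each coordinate must have [y k] as its only ancestor
   in [Y']; this makes the points found below private to [y k]. *)
pose B n := [set z : tuples R n | ((j <= n)%N -> forall k y',
    rcomp g (dn j n) y' (z k) -> y' = y k) /\
  tr (fun M v => sat (FRel R z) v)].
have abv n (z : tuples R n.+1) : exists z', @tuples_ge R n z' z.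
  have /ex_choice [f fP] : forall k, exists u, ge n u (z k).
    by move=> k; exact: ge_above.
  by exists [ffun k => f k] => k; rewrite ffunE.
have upB : upclosed (@tuples_ge R) B.
  move=> n z z' zz' [z'u z'tr]; split=> [jn k y' y'z|].
    apply: z'u; first exact: leqW.
    rewrite /dn downS // -rcompA; exists (z k) => //; exact: zz'.
  by apply: tr_rel_mono z'tr => // k; rewrite /dn down_step; exact: zz'.
have selB : selector (@tuples_ge R) B.
  split=> // n.
  suff [z Bz] : B (maxn j n) !=set0.
    have [z' z'z] := down_above abv z (leq_maxr j n).
    by exists z'; exact: upclosed_down upB z'z Bz.
  move: (maxn j n) (leq_maxl j n) => m jm {n}.
  (* If [B] were empty at level [m], then [R] would be decided negatively at each of the finitely
     many tuples with the right ancestors, against persistence. *)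
  apply: contrapT => B0.
  apply: (gen_consistent gen (i := m)).
  have H (z : tuples R m) : tr (fun M v =>
      (forall k y', rcomp g (dn j m) y' (z k) -> y' = y k) ->
      ~ sat (FRel R z) v).
    have [trz|] := gen_decide gen (FRel R z) (@cobij_id (X m)); last first.
      by apply: (gen_imp gen) => M _ v _; rewrite rcomp_idl.
    have trz' : tr (fun M v => sat (FRel R z) v).
      by apply: (gen_imp gen) trz => M _ v _; rewrite rcomp_idl.
    apply: (gen_imp gen) trz => M _ v _ _ zu _.
    by apply: B0; exists z; split.
  have {}trp := (gen_down gen _ jm).1 trp.
  apply: (gen_imp gen) (gen_and gen trp (tr_all H)) => M MS v av [pv Hv].
  have cgm : cobijective (rcomp g (dn j m)).
    by apply: cobij_comp => //; exact: (@down_cobij levels ge).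
  have [//|z [zu [a za Ra]]] := pv _ _ v cgm av; first by rewrite rcompA.
  apply: (Hv [ffun k => z k]); first by move=> k y'; rewrite ffunE; exact: zu.
  by exists a => // k; rewrite ffunE.
have [S mS SB] := minimal_exists selB.
(* Each projection of [S] is a selector of the original tower, and [a k] is a point inside it. *)
pose U k n := [set u : X n | exists2 z, S n z & z k = u].
have selU k : @selector levels ge (U k).
  split=> [n u u' uu' [z' Sz' ez']|n]; last first.
    by have [z Sz] := mS.1.2 n; exists (z k), z.
  have [z zz'] := abv n z'.
  exists [ffun l => if l == k then u else z l]; last by rewrite ffunE eqxx.
  apply: (mS.1.1 _ _ z') Sz' => l; rewrite ffunE.
  by case: eqP => [->|_]; [rewrite ez' | exact: zz'].
have /ex_choice [a aP] k : exists a : spectral, forall n, sval a n `<=` U k n.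
  by have [a ma aU] := minimal_exists (selU k); exists (exist _ a ma).
have aE k (z : X j) : sval (a k) j z -> g (y k) z /\ forall y', g y' z -> y' = y k.
  move=> /aP [t /SB [/(_ (leqnn j) k) tu _] etk].
  rewrite /dn down_refl rcomp_idr etk in tu; split=> //.
  by have [y' gy'] := cg.1 z; rewrite -(tu y' gy').
exists j, Y', g, y, a; split=> //.
- move=> n x' ax'.
  have /ex_choice [t tP] k : exists t : tuples R n, S n t /\ t k = x' k.
    by have [t St et] := aP k n _ (ax' k); exists t.
  (* Each [x' k] is a coordinate of a tuple in [S], below which [S] eventually lies. A deep tuple of
     [S] is thus below [x'] in every coordinate, and the truth of [R] passes from it up to [x']. *)
  have [m mP] : exists m, forall k, (n <= m)%N /\
      forall l s, (m <= l)%N -> S l s -> dn n l (x' k) (s k).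
    have [|k|m mP] := @finitary_bound _ (fun (k : 'I_(arity R)) m => (n <= m)%N /\
      forall l s, (m <= l)%N -> S l s -> dn n l (x' k) (s k)); last by exists m.
    - move=> k m m' mm' [nm mP]; split; first exact: leq_trans mm'.
      by move=> l s m'l; apply: mP; exact: leq_trans m'l.
    - have [m nm mP] := minimal_focus abv mS (tP k).1.
      exists m; split=> // l s ml Ss; rewrite -(tP k).2.
      exact: tuples_down (mP _ _ ml Ss).
  have [s Ss] := mS.1.2 (maxn n m).
  apply: (tr_rel_mono (z := s)) (SB _ _ Ss).2; last exact: leq_maxl.
  by move=> k; apply: (mP k).2 Ss; exact: leq_maxr.
- move=> k S'; rewrite (bas_down ij) -rcompA => -[z gz Sz].
  by exists z => //; exact: gy.
- move=> k; split.
    have [z az] := (proj2_sig (a k)).1.2 j.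
    by exists z => //; exact: (aE _ _ az).1.
  by move=> y' [z gz az]; exact: (aE _ _ az).2 gz.
Qed.

Lemma spectral_truth (Y : context) (phi : formula L Y) i (h : Y -> set (X i)) :
  cobijective h ->
  (@sat _ spectral _ phi (rcomp h (bas i)) <->
   tr (fun M v => sat phi (rcomp h v))).
Proof.
have excl j (P : predicate L (X j)) : tr P -> tr (fun M v => ~ P M v) -> False.
  move=> t1 t2; apply: (gen_consistent gen (i := j)).
  by apply: (gen_imp gen) (gen_and gen t1 t2) => M _ v _ [].
elim: phi i h => {Y} [Y|Y R x|Y phi IH|Y phi IHphi psi IHpsi|Y Z r cr phi IH]
  i h ch.
- split=> //= t; apply: (gen_consistent gen (i := i)).
  by apply: (gen_imp gen) t.
- split=> [[a xa Ra]|].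
    have /ex_choice [z zP] k : exists z, h (x k) z /\ bas i z (a k).
      by have [z] := xa k; exists z.
    have := Ra i z (fun k => (zP k).2); apply: (gen_imp gen).
    move=> M _ v _ [b zb Rb]; exists b => // k.
    by exists (z k) => //; exact: (zP k).1.
  move=> /(spectral_rel_points ch) [j [Y' [g [y [a [cg Ra sub ya]]]]]].
  by exists a => // k; apply: sub; exact: (ya k).1.
- split=> /= [nphi|t /(IH _ _ ch) t']; last exact: excl t' t.
  by have [/(IH _ _ ch)|] := gen_decide gen phi ch.
- split=> /= [[/(IHphi _ _ ch) t1 /(IHpsi _ _ ch) t2]|t].
    exact: gen_and.
  split; [apply/(IHphi _ _ ch) | apply/(IHpsi _ _ ch)];
    by apply: (gen_imp gen) t => M _ v _ [].
(* Both co-valuations are moved to the common level [m], where the basic cover cancels; the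
   remaining equation between relations holds over every structure. *)
- split=> [[w [[j [g cg ->]] e sw]]|].
    pose m := maxn i j.
    have im : (i <= m)%N := leq_maxl i j.
    have jm : (j <= m)%N := leq_maxr i j.
    have cdj : cobijective (dn j m) by exact: (@down_cobij levels ge).
    have e' : rcomp h (dn i m) = rcomp r (rcomp g (dn j m)).
      apply: (rcomp_cancel (@basic_cobij levels ge _ ge_cobij m)).
        exact: ge_above.
      rewrite !rcompA -/(bas m) -(bas_down im) -(bas_down jm).
      exact: e.
    apply/(gen_down gen _ im).
    have := (gen_down gen _ jm).1 ((IH _ _ cg).1 sw).
    apply: (gen_imp gen) => M _ v av sv /=.
    exists (rcomp g (rcomp (dn j m) v)); split=> //.
      by rewrite -rcompA; apply: adm_rcomp => //; exact: cobij_comp.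
    by rewrite -rcompA e' !rcompA.
  move=> /(gen_exfr gen ch) [j [g [ij cg e t]]].
  exists (rcomp g (bas j)); split; first exact: adm_bas.
    by rewrite (bas_down ij) -!rcompA e.
  exact/(IH _ _ cg).
Qed.

Lemma spectral_structure : is_structure spectral.
Proof.
split=> [Y Z u v [i [h ch ->]] [j [g cg ->]]|Y v R x [i [h ch ->]]].
  have im := leq_maxl i j; have jm := leq_maxr i j.
  exists (X (maxn i j)), (bas (maxn i j)); split.
  - exact: adm_bas_id.
  - exists (rcomp h (dn i (maxn i j))); last by rewrite rcompA -bas_down.
    by apply: cobij_comp => //; exact: (@down_cobij levels ge).
  - exists (rcomp g (dn j (maxn i j))); last by rewrite rcompA -bas_down.
    by apply: cobij_comp => //; exact: (@down_cobij levels ge).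
move=> /(spectral_truth _ ch) /(spectral_rel_points ch).
move=> [j [Y' [g [y [a [cg Ra sub ya]]]]]].
by exists Y', (rcomp g (bas j)), y, a; split=> //; exact: adm_bas.
Qed.

Lemma spectral_topology : has_compact_topology spectral.
Proof.
exists (Topological.class (@spectrum_space levels ge ge_above)); split.
- exact: (@spectrum_compact levels ge).
- exact: (@spectrum_accessible levels ge).
- move=> Y v [i [h ch ->]]; split.
    move=> _ [y _ <-].
    have -> : rcomp h (bas i) y = \bigcup_(x in h y) bas i x.
      by apply/seteqP; split=> S [x]; exists x.
    apply: bigcup_open => x _; exact: (@basic_is_open levels ge).
  apply/seteqP; split=> // S _.
  have [y hy] := (adm_cobijective (adm_bas ch)).1 S.
  by exists (rcomp h (bas i) y) => //; exists y.
- move=> U /(@spectrum_cover_refined levels ge) [n nP].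
  exists (X n), (bas n); split=> //.
  exact: adm_bas_id.
- move=> R.
  (* The complement is a union of open boxes, one for each tuple of variables at which [R] is not
     true. *)
  have -> : interp spectral R = \bigcap_(t in [set t : {i & 'I_(arity R) -> X i} |
      ~ tr (fun M v => sat (FRel R (tagged t)) v)])
      \bigcup_(k in [set: 'I_(arity R)]) ~` (proj k @^-1` bas _ (tagged t k)).
    apply/seteqP; split=> a.
      move=> Ra [i x] /= nt; apply: contrapT => h; apply: nt; apply: Ra => k.
      by apply: contrapT => nk; apply: h; exists k => //; exact: nk.
    move=> h i x ax; apply: contrapT => nt.
    by have [k _] := h (Tagged (fun i => 'I_(arity R) -> X i) x) nt; apply; exact: ax.
  apply: closed_bigI => t _; apply: closed_bigcup => [|k _].
    exact: finite_finset.
  apply: open_closedC; apply: open_comp => [f _|].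
    exact: proj_continuous.
  exact: (@basic_is_open levels ge).
Qed.

Lemma spectral_cofinal : has_cofinal_sequence spectral.
Proof.
exists X, bas; split=> [i|i|Y w].
- exact: adm_bas_id.
- by exists (ge i) => //; exact: (@basic_rcomp levels ge).
- by case=> i; exists i.
Qed.

End SpectralStructure.

(** * Forcing with definable conditions *)

Section Countability.
Variables (L : signature) (cL : L -> nat).
Hypothesis cL_inj : injective cL.

Fixpoint code (X : context) (phi : formula L X) : GenTree.tree nat :=
  match phi with
  | FBot => GenTree.Leaf 0
  | FRel R x => GenTree.Node 1 [:: GenTree.Leaf (cL R);
      GenTree.Leaf (@choice.pickle {ffun 'I_(arity R) -> X} [ffun k => x k])]
  | FNeg psi => GenTree.Node 2 [:: code psi]
  | FAnd psi chi => GenTree.Node 3 [:: code psi; code chi]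
  | FExFr Y ge _ psi => GenTree.Node 4 [:: GenTree.Leaf (choice.pickle Y);
      GenTree.Leaf (@choice.pickle {ffun X * Y -> bool} [ffun p => `[< ge p.1 p.2 >]]); code psi]
  end.

Lemma code_inj (X : context) (phi psi : formula L X) :
  code phi = code psi -> phi = psi.
Proof.
elim: phi psi => {X} [X|X R x|X phi IH|X phi IHphi psi IHpsi|X Y r cr phi IH]
  [|R' x'|phi'|phi' psi'|Y' r' cr' phi'] //=.
- case=> /cL_inj eR; subst R' => /(pcan_inj choice.pickleK) /ffunP ex.
  by congr (FRel R _); apply/funext => k; have := ex k; rewrite !ffunE.
- by case=> /IH ->.
- by case=> /IHphi -> /IHpsi ->.
- case=> /(pcan_inj choice.pickleK) eY; subst Y' => /(pcan_inj choice.pickleK) /ffunP er.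
  move=> /IH <-.
  have err : r = r'.
    apply/funext => x; apply/funext => y; have := er (x, y).
    rewrite !ffunE /= => erxy; apply/propext.
    by split=> /asboolP; [rewrite erxy | rewrite -erxy] => /asboolP.
  by subst r'; rewrite (Prop_irrelevance cr cr').
Qed.

Lemma formula_coding :
  exists c : {Y : context & formula L Y} -> nat * nat, injective c.
Proof.
exists (fun t => (choice.pickle (tag t), choice.pickle (code (tagged t)))).
move=> [Y phi] [Y' phi'] /= e.
have eY : Y = Y' := pcan_inj (@choice.pickleK context) (congr1 fst e).
subst Y'; congr existT; apply: code_inj.
exact: pcan_inj (@choice.pickleK _) _ _ (congr1 snd e).
Qed.

End Countability.

(** Each new level brings new instances of every formula, so the enumeration must return to each
    formula after each level. Pairing the code of [t] with a counter gives the repetitions, and [t0]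
    fills the numbers that code nothing. *)
Lemma infinitely_often (T : Type) (t0 : T) (C : countType) (c : T -> C) :
  injective c ->
  exists e : nat -> T, forall t n, exists2 m, (n <= m)%N & e m = t.
Proof.
move=> c_inj.
have [p p_inj] : exists p : C * nat -> nat, injective p.
  by exists choice.pickle; exact: pcan_inj choice.pickleK.
have [e eP] : exists e : nat -> T, forall n t m, n = p (c t, m) -> t = e n.
  apply: (@ex_choice _ _ (fun n u => forall t m, n = p (c t, m) -> t = u)) => n.
  have [[t [m nm]]|h] := pselect (exists t m, n = p (c t, m)).
    by exists t => t2 m2; rewrite nm => /p_inj [/c_inj].
  by exists t0 => t m nm; case: h; exists t, m.
exists e => t n.
have [m nm] : exists m, (n <= p (c t, m))%N; last first.
  by exists (p (c t, m)) => //; rewrite -(eP _ t m).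
apply: contrapT => h.
have lt m : (p (c t, m) < n)%N.
  by rewrite ltnNge; apply/negP => ?; apply: h; exists m.
have inj : injective (fun m : 'I_n.+1 => Ordinal (lt m)).
  by move=> m m' /(congr1 val) /p_inj [] /val_inj.
by have := leq_card _ inj; rewrite !card_ord ltnn.
Qed.

(** * Conditions, density arguments and the generic chain *)

Section Forcing.
Variables (L : signature) (X0 : context) (K : nat -> predicate L X0).

(* A constant sequence K serves to realize or to omit one type; a decreasing
   one gives compactness. *)
Hypothesis K_structure : forall n (M : protoStructure L) (v : X0 -> set M),
  K n v -> is_structure M /\ adm M X0 v.
Hypothesis K_decreasing : forall n (M : protoStructure L) (v : X0 -> set M),
  K n.+1 v -> K n v.

(** [croot] records how the context fragments the initial co-valuation in [X0], which extensions of
    the condition must leave unchanged. *)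
Record condition := Condition {
  cctx : context;
  croot : X0 -> set cctx;
  cpred : predicate L cctx }.

Definition realizes (n : nat) (c : condition) : predicate L (cctx c) :=
  fun M u => [/\ adm M (cctx c) u, K n (rcomp (@croot c) u) & cpred u].

Definition consistent (c : condition) : Prop :=
  [/\ cobijective (@croot c), definable (@cpred c) &
    forall n, exists (M : protoStructure L) (u : cctx c -> set M),
      realizes n u].

Definition extends (c d : condition) (ge : cctx c -> set (cctx d)) : Prop :=
  [/\ cobijective ge, @croot d = rcomp (@croot c) ge &
    forall (M : protoStructure L) (u : cctx d -> set M),
      cpred u -> cpred (rcomp ge u)].

(** One stage suffices here, while [consistent] asks for all of them: not forcing the negation of a
    predicate means that it is realized at every stage. *)
Definition forces (c : condition) (P : predicate L (cctx c)) : Prop :=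
  exists n, forall (M : protoStructure L) (u : cctx c -> set M),
    realizes n u -> P M u.

Lemma realizes_structure n c (M : protoStructure L) (u : cctx c -> set M) :
  realizes n u -> is_structure M.
Proof. by case=> _ /K_structure []. Qed.

Lemma realizes_decreasing m n c (M : protoStructure L) (u : cctx c -> set M) :
  (m <= n)%N -> realizes n u -> realizes m u.
Proof.
move=> mn [au Ku pu]; split=> //; elim: n mn Ku => [|n IH].
  by rewrite leqn0 => /eqP ->.
by rewrite leq_eqVlt => /predU1P [->//|]; rewrite ltnS => /IH h /K_decreasing.
Qed.

Lemma extends_refl c : extends (@rid (cctx c)).
Proof.
split; first exact: cobij_id; first by rewrite rcomp_idr.
by move=> M u; rewrite rcomp_idl.
Qed.

Lemma extends_trans c d e (f : cctx c -> set (cctx d))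
    (g : cctx d -> set (cctx e)) :
  extends f -> extends g -> extends (rcomp f g).
Proof.
move=> [cf rf pf] [cg rg pg]; split; first exact: cobij_comp.
  by rewrite rg rf rcompA.
by move=> M u /pg /pf; rewrite rcompA.
Qed.

Lemma realizes_extends n c d (f : cctx c -> set (cctx d))
    (M : protoStructure L) (u : cctx d -> set M) :
  extends f -> realizes n u -> realizes n (rcomp f u).
Proof.
move=> [cf rf pf] [au Ku pu]; split; first exact: adm_rcomp.
  by rewrite -rcompA -rf.
exact: pf.
Qed.

Lemma forces_imp c (P Q : predicate L (cctx c)) :
  (forall M : protoStructure L, is_structure M ->
    forall u, adm M (cctx c) u -> P M u -> Q M u) -> forces P -> forces Q.
Proof.
move=> PQ [n nP]; exists n => M u r; apply: PQ (nP _ _ r).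
  exact: realizes_structure r.
by case: r.
Qed.

Lemma forces_extends c d (f : cctx c -> set (cctx d)) (P : predicate L (cctx c)) :
  extends f -> forces P -> forces (fun M u => P M (rcomp f u)).
Proof.
by move=> fe [n nP]; exists n => M u /(realizes_extends fe) /nP.
Qed.

Lemma forces_and c (P Q : predicate L (cctx c)) :
  forces P -> forces Q -> forces (fun M u => P M u /\ Q M u).
Proof.
move=> [m mP] [n nQ]; exists (maxn m n) => M u r; split.
  exact/mP/(realizes_decreasing (leq_maxl m n) r).
exact/nQ/(realizes_decreasing (leq_maxr m n) r).
Qed.

Lemma forces_consistent c : consistent c ->
  ~ forces (fun M (u : cctx c -> set M) => False).
Proof. by move=> [_ _ real] [n nP]; have [M [u /nP]] := real n. Qed.

(** If every [t] failed at some stage, it would fail from there on, and a common later stage would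
    refute all of them. *)
Lemma realizes_pigeonhole c (T : Type) (Q : T -> predicate L (cctx c)) :
  finitary T ->
  (forall n, exists (M : protoStructure L) (u : cctx c -> set M),
    realizes n u /\ exists t, Q t M u) ->
  exists t, forall n, exists (M : protoStructure L) (u : cctx c -> set M),
    realizes n u /\ Q t M u.
Proof.
move=> [I [f fS]] H; apply: contrapT => /forallNP h.
have [i m n mn P M u /(realizes_decreasing mn)|i|n nP] :=
    @finitary_bound I (fun i n => forall (M : protoStructure L)
      (u : cctx c -> set M), realizes n u -> ~ Q (f i) M u).
- exact: P.
- have /existsNP [n /forallNP nP] := h (f i).
  by exists n => M u r q; apply: (nP M); exists u.
- have [M [u [r [t]]]] := H n; have [i <-] := fS t; exact: nP.
Qed.

(** Amalgams of [u] and [w] have finitely many shapes, so one shape occurs at all stages and becomes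
    the new context. [Q] is kept in a single structure only: in its uses it compares co-valuations,
    and cancellation turns one instance into a fact about the relations [ge] and [g]. *)
Lemma consistent_extend c (Y : context) (P : predicate L Y)
    (Q : forall M : protoStructure L, (cctx c -> set M) -> (Y -> set M) -> Prop) :
  consistent c -> definable P ->
  (forall n, exists (M : protoStructure L) (u : cctx c -> set M)
     (w : Y -> set M), [/\ realizes n u, adm M Y w, P M w & Q M u w]) ->
  exists d (ge : cctx c -> set (cctx d)) (g : Y -> set (cctx d)),
    [/\ consistent d, extends ge, cobijective g,
     forces (fun M u => P M (rcomp g u)) &
     exists (M : protoStructure L) (u : cctx d -> set M),
       adm M _ u /\ Q M (rcomp ge u) (rcomp g u)].
Proof.
move=> [cc dc real] dP H.
have H1 n : exists (M : protoStructure L) (u : cctx c -> set M),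
    realizes n u /\ exists (S : amalgam_index (cctx c) Y)
      (ab : (cctx c -> set (bctx S)) * (Y -> set (bctx S))),
    [/\ cobijective ab.1, cobijective ab.2 & exists u', [/\ adm M _ u',
      u = rcomp ab.1 u', P M (rcomp ab.2 u') & Q M u (rcomp ab.2 u')]].
  have [M [u [w [r aw Pw Qw]]]] := H n; exists M, u; split=> //.
  have [au _ _] := r.
  have [S [a [b [u' [ca cb au' eu ew]]]]] :=
    amalgam (realizes_structure r) au aw.
  by exists S, (a, b); split=> //; exists u'; rewrite -ew.
have [S /realizes_pigeonhole [|[a b] /= {}H1]] :=
  realizes_pigeonhole (finitary_finType _) H1.
  by apply: finitary_pair; exact: finitary_rel.
have [M0 [u0 [_ [ca cb _]]]] := H1 0.
exists (@Condition (bctx S) (rcomp (@croot c) a)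
  (fun M u => cpred (rcomp a u) /\ P M (rcomp b u))), a, b; split=> //.
- split=> /=; first exact: cobij_comp.
    by apply: definable_and; exact: definable_subst.
  move=> n; have [M [u [[au Ku pu] [_ _ [u' [au' eu Pu' _]]]]]] := H1 n.
  by exists M, u'; split=> //=; rewrite ?rcompA -eu.
- by split=> // M u [].
- by exists 0 => M u [_ _ []].
- have [M [u [_ [_ _ [u' [au' eu _ Qu']]]]]] := H1 0.
  by exists M, u'; rewrite -eu.
Qed.

Lemma forces_decide c (Y : context) (h : Y -> set (cctx c)) (P : predicate L Y) :
  consistent c -> cobijective h -> definable P ->
  forces (fun M u => ~ P M (rcomp h u)) \/
  exists d (ge : cctx c -> set (cctx d)), [/\ consistent d, extends ge &
    forces (fun M u => P M (rcomp (rcomp h ge) u))].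
Proof.
move=> con ch dP.
have [|nf] := pselect (forces (fun M u => ~ P M (rcomp h u))); first by left.
right.
have [n|d [ge [g [cd eg cg fP [M [u [au e]]]]]]] :=
    @consistent_extend c Y P (fun M u w => w = rcomp h u) con dP.
  have /forallNP /(_ n) /existsNP [M /existsNP [u /not_implyP [r /contrapT p]]] :=
    nf.
  exists M, u, (rcomp h u); split=> //.
  by have [au _ _] := r; exact: adm_rcomp.
exists d, ge; split=> //.
have <- : g = rcomp h ge; last by [].
by apply: (rcomp_cancel (adm_cobijective au)); rewrite e rcompA.
Qed.

(** The Henkin witness that a forced formula still needs: a persistent tuple for an atom, a
    fragmentation for a quantifier. *)
Definition witnessed (c : condition) (Y : context) (phi : formula L Y) :
    (Y -> set (cctx c)) -> Prop :=
  match phi with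
  | FRel R x => fun h => exists (Y' : context) (g : Y' -> set (cctx c))
      (y : 'I_(arity R) -> Y'), [/\ cobijective g,
        forall k, g (y k) `<=` h (x k) &
        forces (fun M u => persistent y (rcomp g u))]
  | FExFr Z r _ psi => fun h => exists g : Z -> set (cctx c),
      [/\ cobijective g, h = rcomp r g &
        forces (fun M u => sat psi (rcomp g u))]
  | _ => fun _ => True
  end.

Definition settled (c : condition) (Y : context) (phi : formula L Y)
    (h : Y -> set (cctx c)) : Prop :=
  forces (fun M u => ~ sat phi (rcomp h u)) \/
  forces (fun M u => sat phi (rcomp h u)) /\ witnessed phi h.

Lemma settled_extends c d (f : cctx c -> set (cctx d)) (Y : context)
    (phi : formula L Y) (h : Y -> set (cctx c)) :
  extends f -> settled phi h -> settled phi (rcomp h f).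
Proof.
move=> fe [|[]] => [np|p w]; [left|right; split].
- by apply: forces_imp (forces_extends fe np) => M _ u _; rewrite rcompA.
- by apply: forces_imp (forces_extends fe p) => M _ u _; rewrite rcompA.
case: phi p w => //= [R x _ [Y' [g [y [cg gy pe]]]]|Z r cr psi _ [g [cg -> p]]].
  exists Y', (rcomp g f), y; split.
  - by apply: cobij_comp => //; case: fe.
  - by move=> k z [t /gy ht ft]; exists t.
  - by apply: forces_imp (forces_extends fe pe) => M _ u _; rewrite rcompA.
exists (rcomp g f); split; first by apply: cobij_comp => //; case: fe.
  by rewrite rcompA.
by apply: forces_imp (forces_extends fe p) => M _ u _; rewrite rcompA.
Qed.

(* The quotient of the context by the indices k with [y k = z] bounds its size
   in terms of the arity of R alone. *)
Lemma strong_rel_bounded (M : protoStructure L) (X : context) (v : X -> set M)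
    (R : L) (x : 'I_(arity R) -> X) :
  is_structure M -> adm M X v -> sat (FRel R x) v ->
  exists (S : {set 'I_#|{: {set 'I_(arity R)}}| }) (y : 'I_(arity R) -> bctx S)
    (w : bctx S -> set M), [/\ adm M _ w, persistent y w &
    forall k, w (y k) `<=` v (x k)].
Proof.
move=> MS av sx; have [Y [w [y [a [aw sub Ra ya]]]]] := MS.2 _ _ _ _ av sx.
pose f (z : Y) := [set k | y k == z]%SET.
have [S [q [cq qP]]] := quotient f.
have /ex_choice [y' y'P] k : exists z, q z (y k) by exact: cq.1.
(* The invariant of [y k] contains [k], which no other variable shares, so its block is a
   singleton. *)
have quniq k z : q (y' k) z -> z = y k.
  move=> /(qP _ _ _ (y'P k)) /setP /(_ k).
  by rewrite !inE eqxx => /eqP ->.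
exists S, y', (rcomp q w); split; first exact: adm_rcomp.
- apply: persistent_point Ra _ => k z' [z qz /(ya k).2 ez].
  have [t qt tu] := cobij_private (y' k) cq.
  have ety : t = y k := quniq _ _ qt.
  by apply: tu; rewrite ety -ez.
- by move=> k s [z /quniq -> ws]; exact: sub.
Qed.

Lemma settled_dense c (Y : context) (phi : formula L Y) (h : Y -> set (cctx c)) :
  consistent c -> cobijective h ->
  exists d (ge : cctx c -> set (cctx d)),
    [/\ consistent d, extends ge & settled phi (rcomp h ge)].
Proof.
move=> con ch.
have [np|[d [f [con' fe p]]]] := forces_decide con ch (definable_sat phi).
  exists c, (@rid _); split=> //; first exact: extends_refl.
  by rewrite rcomp_idr; left.
have {ch} : cobijective (rcomp h f) by apply: cobij_comp => //; case: fe.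
suff H c1 (con1 : consistent c1) (h1 : Y -> set (cctx c1)) : cobijective h1 ->
    forces (fun M u => sat phi (rcomp h1 u)) ->
    exists d1 (ge1 : cctx c1 -> set (cctx d1)), [/\ consistent d1, extends ge1 &
      witnessed phi (rcomp h1 ge1)].
  move=> /(H d con') /(_ p) [d1 [f1 [con1 f1e w1]]].
  exists d1, (rcomp f f1); split=> //; first exact: extends_trans.
  rewrite -rcompA; right; split=> //.
  by apply: forces_imp (forces_extends f1e p) => M _ u _; rewrite !rcompA.
move=> {c con h d f con' fe p} ch1.
have triv : witnessed phi h1 -> exists d1 (ge1 : cctx c1 -> set (cctx d1)),
    [/\ consistent d1, extends ge1 & witnessed phi (rcomp h1 ge1)].
  move=> w; exists c1, (@rid _); split=> //; first exact: extends_refl.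
  by rewrite rcomp_idr.
case: phi triv => [triv|R x _|psi triv|psi chi triv|Z r cr psi _] p;
  [exact: triv| |exact: triv|exact: triv|].
(* The context of the persistent tuple is bounded by the arity, so one context and one tuple serve
   at all stages; stages past [n0] make the atom hold. *)
- have [n0 n0P] := p.
  have H1 n : exists (M : protoStructure L) (u : cctx c1 -> set M),
      realizes n u /\ exists (S : {set 'I_#|{: {set 'I_(arity R)}}| })
        (y : 'I_(arity R) -> bctx S) (w : bctx S -> set M), [/\ adm M _ w,
        persistent y w & forall k, w (y k) `<=` rcomp h1 u (x k)].
    have [_ _ /(_ (maxn n n0)) [M [u r]]] := con1.
    exists M, u; split; first exact: realizes_decreasing (leq_maxl _ _) r.
    have r0 := realizes_decreasing (leq_maxr n n0) r.
    apply: strong_rel_bounded; first exact: realizes_structure r.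
      by have [au _ _] := r; exact: adm_rcomp.
    exact: n0P r0.
  have [S /realizes_pigeonhole [|y H2]] :=
    realizes_pigeonhole (finitary_finType _) H1; first exact: finitary_fun.
  have [n|d [ge [g [cd eg cg fP [M [u [au e]]]]]]] := @consistent_extend c1 (bctx S)
      (fun M w => persistent y w)
      (fun M u w => forall k, w (y k) `<=` rcomp h1 u (x k)) con1
      (definable_persistent y).
    by have [M [u [r [w [aw pw sub]]]]] := H2 n; exists M, u, w.
  exists d, ge; split=> //; exists (bctx S), g, y; split=> // k.
  apply: (rcomp_sub (adm_cobijective au)).
  by rewrite rcompA; exact: e.
- have [n0 n0P] := p.
  have [n|d [ge [g [cd eg cg fP [M [u [au e]]]]]]] := @consistent_extend c1 Z
      (fun M w => sat psi w) (fun M u w => rcomp h1 u = rcomp r w) con1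
      (definable_sat psi).
    have [_ _ /(_ (maxn n n0)) [M [u re]]] := con1.
    have re0 := realizes_decreasing (leq_maxr n n0) re.
    have [w [aw e sw]] := n0P _ _ re0.
    exists M, u, w; split=> //; exact: realizes_decreasing (leq_maxl _ _) re.
  exists d, ge; split=> //; exists g; split=> //.
  apply: (rcomp_cancel (adm_cobijective au)).
  by rewrite !rcompA.
Qed.

(** There are finitely many relations [h] from [Y] to the present context, and a requirement once
    met survives extension. Relations to the enlarged context are left to later steps of the
    chain. *)
Lemma dense_all (Y : context) (D : forall c, (Y -> set (cctx c)) -> Prop) :
  (forall c d (f : cctx c -> set (cctx d)) h, extends f -> D c h ->
     D d (rcomp h f)) ->
  (forall c h, consistent c -> cobijective h ->
    exists d (ge : cctx c -> set (cctx d)),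
      [/\ consistent d, extends ge & D d (rcomp h ge)]) ->
  forall c, consistent c -> exists d (ge : cctx c -> set (cctx d)),
    [/\ consistent d, extends ge &
      forall h, cobijective h -> D d (rcomp h ge)].
Proof.
move=> Dext Ddense c con.
have [I [H HS]] := finitary_rel Y (cctx c).
suff [d [ge [cd ege P]]] : exists d (ge : cctx c -> set (cctx d)),
    [/\ consistent d, extends ge & forall i, i \in enum I ->
      cobijective (H i) -> D d (rcomp (H i) ge)].
  exists d, ge; split=> // h; have [i <-] := HS h; apply: P.
  by rewrite mem_enum.
elim: (enum I) => [|i s [d [f [cd fe P]]]].
  by exists c, (@rid _); split=> //; exact: extends_refl.
have [cH|ncH] := pselect (cobijective (H i)); last first.
  exists d, f; split=> // j; rewrite inE => /predU1P [->//|]; exact: P.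
have [|e [g [ce ge De]]] := Ddense d (rcomp (H i) f) cd.
  by apply: cobij_comp => //; case: fe.
exists e, (rcomp f g); split=> //; first exact: extends_trans.
move=> j; rewrite inE => /predU1P [->|js cHj]; first by rewrite -rcompA.
by rewrite -rcompA; apply: Dext => //; exact: P.
Qed.

Variables (Xe : context) (omit : set (formula L Xe)).

Definition omitted (c : condition) (h : Xe -> set (cctx c)) : Prop :=
  exists2 psi, omit psi & forces (fun M u => ~ sat psi (rcomp h u)).

Hypothesis omitted_dense : forall c h, consistent c -> cobijective h ->
  exists d (ge : cctx c -> set (cctx d)),
    [/\ consistent d, extends ge & omitted (rcomp h ge)].

Lemma omitted_extends c d (f : cctx c -> set (cctx d)) (h : Xe -> set (cctx c)) :
  extends f -> omitted h -> omitted (rcomp h f).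
Proof.
move=> fe [psi opsi np]; exists psi => //.
by apply: forces_imp (forces_extends fe np) => M _ u _; rewrite rcompA.
Qed.

Hypothesis K_nonempty : forall n, exists (M : protoStructure L)
  (v : X0 -> set M), K n v.

Variable e : nat -> {Y : context & formula L Y}.
Hypothesis e_often : forall t n, exists2 m, (n <= m)%N & e m = t.

Let consistent_condition := {c | consistent c}.

Lemma chain_step n (c : consistent_condition) :
  exists q : {d : consistent_condition & cctx (sval c) -> set (cctx (sval d))},
  [/\ extends (projT2 q),
    (forall h, cobijective h ->
       settled (tagged (e n)) (rcomp h (projT2 q))) &
    (forall h, cobijective h -> omitted (rcomp h (projT2 q)))].
Proof.
have [d [f [cd fe fP]]] := @dense_all _ (fun c => @settled c _ (tagged (e n)))
  (fun c d f h => @settled_extends c d f _ _ h)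
  (fun c h => @settled_dense c _ _ h) _ (proj2_sig c).
have [d' [f' [cd' fe' fP']]] :=
  @dense_all _ omitted omitted_extends omitted_dense _ cd.
exists (existT (fun d : consistent_condition =>
  cctx (sval c) -> set (cctx (sval d))) (exist _ d' cd') (rcomp f f')).
split=> /=; first exact: extends_trans.
  by move=> h /fP; rewrite -rcompA; exact: settled_extends.
move=> h ch; rewrite -rcompA; apply: fP'.
by apply: cobij_comp => //; case: fe.
Qed.

Lemma root_consistent :
  consistent (@Condition X0 (@rid X0) (fun M u => True)).
Proof.
split; [exact: cobij_id | exact (@definable_cst L X0 True) |].
move=> n; have [M [v Kv]] := K_nonempty n.
by exists M, v; split=> //=; [case: (K_structure Kv) | rewrite rcomp_idl].
Qed.

Fixpoint chain (n : nat) : consistent_condition :=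
  match n with
  | 0 => exist _ _ root_consistent
  | n'.+1 => projT1 (sval (cid (chain_step n' (chain n'))))
  end.

Definition chain_ctx (n : nat) : context := cctx (sval (chain n)).

Definition chain_ge (n : nat) : chain_ctx n -> set (chain_ctx n.+1) :=
  projT2 (sval (cid (chain_step n (chain n)))).

Lemma chain_extends n : extends (@chain_ge n).
Proof. by have [] := proj2_sig (cid (chain_step n (chain n))). Qed.

Lemma chain_settled n (h : tag (e n) -> set (chain_ctx n)) :
  cobijective h -> @settled (sval (chain n.+1)) _ (tagged (e n))
    (rcomp h (@chain_ge n)).
Proof. by have [_ H1 H2] := proj2_sig (cid (chain_step n (chain n))); auto. Qed.

Lemma chain_omitted n (h : Xe -> set (chain_ctx n)) :
  cobijective h -> @omitted (sval (chain n.+1)) (rcomp h (@chain_ge n)).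
Proof. by have [_ H1 H2] := proj2_sig (cid (chain_step n (chain n))); auto. Qed.

Let cdn i j : chain_ctx i -> set (chain_ctx j) := @dn chain_ctx chain_ge i j.

Lemma chain_dn_extends i j : (i <= j)%N ->
  @extends (sval (chain i)) (sval (chain j)) (@cdn i j).
Proof.
elim: j => [|j IH].
  by rewrite leqn0 => /eqP ->; rewrite /cdn /dn down_refl; exact: extends_refl.
rewrite leq_eqVlt => /predU1P [->|].
  by rewrite /cdn /dn down_refl; exact: extends_refl.
rewrite ltnS => ij; rewrite /cdn /dn downS //.
by apply: extends_trans (IH ij) _; exact: chain_extends.
Qed.

(** Forcing survives extension, so this is an increasing union along the chain; it serves as the
    truth predicate of the generic tower. *)
Definition eventually_forced (i : nat) (P : predicate L (chain_ctx i)) : Prop :=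
  exists2 j, (i <= j)%N &
    @forces (sval (chain j)) (fun M u => P M (rcomp (@cdn i j) u)).

Let cdn_trans i j k : (i <= j)%N -> (j <= k)%N ->
  rcomp (@cdn i j) (@cdn j k) = @cdn i k.
Proof. exact: (@down_trans (levels chain_ctx) chain_ge). Qed.

Lemma eventually_forced_later i (P : predicate L (chain_ctx i)) j k :
  (i <= j)%N -> (j <= k)%N ->
  @forces (sval (chain j)) (fun M u => P M (rcomp (@cdn i j) u)) ->
  @forces (sval (chain k)) (fun M u => P M (rcomp (@cdn i k) u)).
Proof.
move=> ij jk /(forces_extends (chain_dn_extends jk)).
by apply: forces_imp => M _ u _; rewrite -rcompA cdn_trans.
Qed.

Lemma eventually_forced_settled i (Y : context) (h : Y -> set (chain_ctx i))
    (phi : formula L Y) : cobijective h ->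
  exists2 j, (i <= j)%N & @settled (sval (chain j)) _ phi (rcomp h (@cdn i j)).
Proof.
move=> ch; have [m im em] := e_often (Tagged _ phi) i.
have ch' : cobijective (rcomp h (@cdn i m)).
  by apply: cobij_comp => //; case: (chain_dn_extends im).
exists m.+1; first exact: leqW.
have H := @chain_settled m; rewrite em /= in H.
have := H _ ch'; rewrite rcompA.
by rewrite /cdn /dn (downS chain_ge im).
Qed.

Lemma chain_generic : @generic L chain_ctx chain_ge eventually_forced.
Proof.
have adm_cdn i j (M : protoStructure L) (u : chain_ctx j -> set M) :
    (i <= j)%N -> adm M _ u -> adm M _ (rcomp (@cdn i j) u).
  by move=> ij au; apply: adm_rcomp => //; case: (chain_dn_extends ij).
split.
- by move=> n; case: (chain_extends n).
- move=> i P Q PQ [j ij f]; exists j => //.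
  apply: forces_imp f => M MS u au; apply: PQ => //; exact: adm_cdn.
- move=> i P Q [j ij f] [k ik g]; exists (maxn j k).
    exact: leq_trans (leq_maxl j k).
  by apply: forces_and; [apply: eventually_forced_later f
                        |apply: eventually_forced_later g];
    rewrite ?leq_maxl ?leq_maxr.
- move=> i [j ij]; exact/forces_consistent/(proj2_sig (chain j)).
- move=> i j P ij; split=> [[k ik f]|[k jk f]].
    exists (maxn j k); first exact: leq_maxl.
    have := eventually_forced_later ik (leq_maxr j k) f.
    apply: forces_imp => M _ u _.
    by rewrite -(cdn_trans ij (leq_maxl j k)) rcompA.
  exists k; first exact: leq_trans jk.
  by apply: forces_imp f => M _ u _; rewrite -(cdn_trans ij jk) rcompA.
- move=> i Y h phi ch.
  have [j ij [np|[p _]]] := eventually_forced_settled phi ch.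
    by right; exists j => //; apply: forces_imp np => M _ u _; rewrite rcompA.
  by left; exists j => //; apply: forces_imp p => M _ u _; rewrite rcompA.
- move=> i Y Z h r cr phi ch [k ik f].
  have [j ij [np|[_ [g [cg eg p]]]]] := eventually_forced_settled (FExFr cr phi) ch.
    have jm := leq_maxl j k; have km := leq_maxr j k.
    have f' := eventually_forced_later
      (P := fun M v => sat (FExFr cr phi) (rcomp h v)) ik km f.
    case: (forces_consistent (proj2_sig (chain (maxn j k)))).
    have := forces_and (forces_extends (chain_dn_extends jm) np) f'.
    apply: forces_imp => M _ u _ [nsat ssat]; apply: nsat.
    by rewrite rcompA -(rcompA (@cdn i j)) cdn_trans.
  exists j, g; split=> //; exists j => //.
  by apply: forces_imp p => M _ u _; rewrite /cdn /dn down_refl rcomp_idl.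
- move=> i Y h R x ch [k ik f].
  have [j ij [np|[_ [Y' [g [y [cg gy p]]]]]]] := eventually_forced_settled (FRel R x) ch.
    have jm := leq_maxl j k; have km := leq_maxr j k.
    have f' := eventually_forced_later
      (P := fun M v => sat (FRel R x) (rcomp h v)) ik km f.
    case: (forces_consistent (proj2_sig (chain (maxn j k)))).
    have := forces_and (forces_extends (chain_dn_extends jm) np) f'.
    apply: forces_imp => M _ u _ [nsat ssat]; apply: nsat.
    by rewrite rcompA -(rcompA (@cdn i j)) cdn_trans.
  exists j, Y', g, y; split=> //; exists j => //.
  by apply: forces_imp p => M _ u _; rewrite /cdn /dn down_refl rcomp_idl.
Qed.

End Forcing.

Theorem generic_structure (L : signature) (X0 : context) (K : nat -> predicate L X0)
    (Xe : context) (omit : set (formula L Xe)) :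
  countable [set: L] ->
  (forall n (M : protoStructure L) (v : X0 -> set M),
     K n M v -> is_structure M /\ adm M X0 v) ->
  (forall n (M : protoStructure L) (v : X0 -> set M), K n.+1 M v -> K n M v) ->
  (forall n, exists (M : protoStructure L) (v : X0 -> set M), K n M v) ->
  (forall c (h : Xe -> set (cctx c)), consistent K c -> cobijective h ->
     exists d (ge : cctx c -> set (cctx d)),
       [/\ consistent K d, extends ge & omitted K omit (rcomp h ge)]) ->
  exists (N : protoStructure L) (v0 : X0 -> set N),
    [/\ is_structure N, has_compact_topology N /\ has_cofinal_sequence N,
     adm N X0 v0,
     forall (Y : context) (h : Y -> set X0) (phi : formula L Y), cobijective h ->
       (exists n, forall (M : protoStructure L) (v : X0 -> set M), K n M v ->
         sat phi (rcomp h v)) -> sat phi (rcomp h v0) &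
     forall w : Xe -> set N, adm N Xe w -> exists2 psi, omit psi & ~ sat psi w].
Proof.
move=> /countable_injP [cL cL_inj] KS Kdec Kne dense.
have {}cL_inj : injective cL by move=> R R'; apply: cL_inj; rewrite in_setE.
have [c c_inj] := formula_coding cL_inj.
have [e eP] := infinitely_often (existT _ star FBot) c_inj.
have gen := chain_generic KS Kdec dense Kne eP.
pose N := spectral gen.
exists N, (@bas (chain_ctx KS Kdec dense Kne e) _ 0); split.
- exact: spectral_structure.
- by split; [exact: spectral_topology | exact: spectral_cofinal].
- exact: (adm_bas_id gen 0).
- move=> Y h phi ch [n nP].
  apply: (@spectral_truth _ _ _ _ gen Y phi 0 h ch).2.
  (* The root condition demands nothing beyond membership in the classes, so a consequence of one
     [K n] is forced already there. *)
  exists 0 => //; exists n => M u [_ Ku _].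
  rewrite /dn down_refl rcomp_idl; apply: nP.
  by rewrite rcomp_idl in Ku.
(* An admissible co-valuation comes from some level [i], and its omission requirement is met in
   passing to level [i.+1]. *)
- move=> w [i [h ch ->]].
  have [psi opsi f] := chain_omitted ch.
  exists psi => //; apply: (spectral_truth gen (FNeg psi) ch).2.
  exists i.+1 => //; apply: forces_imp f => // M _ u _.
  by rewrite /dn down_step -rcompA.
Qed.

(** * Types *)

Section Types.
Variables (L : signature) (T : set (sentence L)).
Implicit Types M N : protoStructure L.

Definition type_of (X : context) M (v : X -> set M) : set (formula L X) :=
  [set phi | sat phi v].

Lemma types_realized (X : context) (p : set (formula L X)) : types T p ->
  exists M (v : X -> set M), [/\ is_model T M, adm M X v & p = type_of v].
Proof.
move=> [cp [M [v [MT av pv]]]]; exists M, v; split=> //.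
apply/seteqP; split=> phi; first exact: pv.
by move=> sphi; have [//|/pv] := cp phi.
Qed.

Lemma type_of_types (X : context) M (v : X -> set M) :
  is_model T M -> adm M X v -> types T (type_of v).
Proof.
move=> MT av; split; last by exists M, v.
by move=> phi; have [|] := pselect (sat phi v); [left | right].
Qed.

Lemma types_sub (X : context) (p q : set (formula L X)) :
  types T p -> types T q -> p `<=` q -> p = q.
Proof.
move=> [cp _] tq sub; apply/seteqP; split=> // phi.
have [M [v [_ _ eq]]] := types_realized tq; rewrite eq => sphi.
by have [//|/sub] := cp phi; rewrite eq.
Qed.

Lemma model_nonempty M : is_model T M -> exists a : M, True.
Proof.
move=> [_ [v /adm_cobijective [_ /(_ [` (fset11 0)]%fset) [a _]]] _].
by exists a.
Qed.

Lemma adm_nonempty (X : context) M (v : X -> set M) :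
  is_model T M -> adm M X v -> exists x : X, True.
Proof.
move=> /model_nonempty [a _] /adm_cobijective [/(_ a) [x _] _].
by exists x.
Qed.

Lemma star_eq (x y : star) : x = y.
Proof.
apply: val_inj; have := fsvalP x; have := fsvalP y.
by rewrite !in_fset1 /= => /eqP -> /eqP ->.
Qed.

Lemma adm_star M (v : star -> set M) : adm M star v -> v = (fun _ _ => True).
Proof.
move=> /adm_cobijective [v1 _]; apply/funext => x; apply/seteqP; split=> // a _.
by have [y] := v1 a; rewrite (star_eq x y).
Qed.

(** [phi] belongs to [p]: a realization of [phi] has type [p], since complete realized types are
    never properly included in one another. *)
Lemma isolated_type_of (X : context) (p : set (formula L X)) (phi : formula L X) :
  types T p -> realized T [set phi] ->
  (forall M (v : X -> set M), is_model T M -> adm M X v -> sat phi v ->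
     forall psi, p psi -> sat psi v) ->
  forall M (v : X -> set M), is_model T M -> adm M X v ->
    (sat phi v <-> p = type_of v).
Proof.
move=> tp [M0 [v0 [M0T av0 s0]]] iso M v MT av; split=> [sv|ep].
  by apply: types_sub => //; [exact: type_of_types | exact: iso sv].
have e0 : p = type_of v0.
  apply: types_sub => //; first exact: type_of_types.
  by apply: iso => //; exact: s0.
have : type_of v phi by rewrite -ep e0; exact: s0.
by [].
Qed.

(** The isolating formula is a conjunction with one conjunct for each other type, taken from [p] and
    false in that type. *)
Lemma finite_isolated (X : context) :
  finite_set (@types L T X) ->
  forall p : set (formula L X), types T p -> isolated T p.
Proof.
move=> /finite_seqP [s es] p tp.
have inS q : types T q -> q \in s by move=> tq; have : [set` s] q by rewrite -es.
have /ex_choice [psi psiP] : forall q, exists phi, types T q -> q <> p ->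
    p phi /\ ~ q phi.
  move=> q; apply: contrapT => /forallNP h.
  have /not_implyP [tq /not_implyP [qp _]] := h FBot.
  apply: qp; apply: esym; apply: types_sub => // phi pphi.
  by apply: contrapT => nq; apply: (h phi).
(* The guard drops arbitrary values of [psi] that lie outside [p], such as may occur at [p]
   itself. *)
have [phi phiP] : definable (fun M (v : X -> set M) => forall i : 'I_(size s),
    p (psi (nth p s i)) -> sat (psi (nth p s i)) v).
  refine (definable_all _ _) => [|i]; first exact: finitary_finType.
  have [pi|npi] := pselect (p (psi (nth p s i))).
    apply: eq_definable (definable_sat (psi (nth p s i))) => M _ v _.
    by split=> //; apply.
  by apply: eq_definable (@definable_cst L X True) => M _ v _; split.
have [M0 [v0 [M0T av0 e0]]] := types_realized tp.
exists phi.
  exists M0, v0; split=> // _ ->.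
  have [M0S _ _] := M0T.
  by apply/(phiP _ M0S _ av0) => i; rewrite e0.
move=> M v MT av; have [MS _ _] := MT => /(phiP _ MS _ av) h.
have tv := type_of_types MT av.
have [ev|nv] := pselect (type_of v = p); first by rewrite -ev.
have [pv nsv] := psiP _ tv nv; case: nsv.
have iv : (index (type_of v) s < size s)%N by rewrite index_mem; exact: inS.
have := h (Ordinal iv); rewrite /= nth_index; last exact: inS.
exact.
Qed.

Hypothesis L_countable : countable [set: L].

Theorem generic_model (X0 : context) (K : nat -> predicate L X0)
    (Xe : context) (omit : set (formula L Xe)) :
  (forall n M (v : X0 -> set M), K n M v -> is_model T M /\ adm M X0 v) ->
  (forall n M (v : X0 -> set M), K n.+1 M v -> K n M v) ->
  (forall n, exists M (v : X0 -> set M), K n M v) ->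
  (forall c (h : Xe -> set (cctx c)), consistent K c -> cobijective h ->
     exists d (ge : cctx c -> set (cctx d)),
       [/\ consistent K d, extends ge & omitted K omit (rcomp h ge)]) ->
  exists N (v0 : X0 -> set N),
    [/\ compact_omega_model T N, adm N X0 v0,
     forall phi : formula L X0,
       (exists n, forall M (v : X0 -> set M), K n M v -> sat phi v) ->
       sat phi v0 &
     forall w : Xe -> set N, adm N Xe w -> exists2 psi, omit psi & ~ sat psi w].
Proof.
move=> KT Kdec Kne dense.
have KS n M (v : X0 -> set M) : K n M v -> is_structure M /\ adm M X0 v.
  by move=> /KT [[]].
have [N [v0 [NS [Nt Nc] av0 truth om]]] :=
  generic_structure L_countable KS Kdec Kne dense.
exists N, v0; split=> // [|phi [n nP]]; last first.
  rewrite -[v0]rcomp_idl; apply: truth; first exact: cobij_id.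
  by exists n => M v /nP; rewrite rcomp_idl.
split=> //; have [M [v Kv]] := Kne 0; have [MT av] := KT _ _ _ Kv.
have [x _] := adm_nonempty MT av.
(* Sentences are read at the consolidation of [v0] by the total relation, which is co-bijective
   because [X0] is nonempty. *)
pose h : star -> set X0 := fun _ _ => True.
have ch : cobijective h.
  split=> [y|y]; first by exists [` (fset11 0)]%fset.
  by exists x; split=> // y' _; exact: star_eq.
split=> //; first by exists (rcomp h v0); exact: adm_rcomp.
move=> phi Tphi; exists (rcomp h v0); first exact: adm_rcomp.
apply: truth => //; exists 0 => M' v' /KT [[_ _ /(_ phi Tphi) [u au su]] av'].
by rewrite (adm_star (adm_rcomp ch av')) -(adm_star au).
Qed.

(** [FBot] fails everywhere, so omitting it is no demand; this serves for generic models in which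
    nothing has to be omitted. *)
Lemma no_omission (X0 : context) (K : nat -> predicate L X0) c
    (h : X0 -> set (cctx c)) : consistent K c -> cobijective h ->
  exists d (ge : cctx c -> set (cctx d)),
    [/\ consistent K d, extends ge & omitted K [set FBot] (rcomp h ge)].
Proof.
move=> con ch; exists c, (@rid _); split=> //; first exact: extends_refl.
by exists FBot => //; exists 0 => M u _ [].
Qed.

Lemma compact_realization (X : context) (p : set (formula L X)) :
  realized T p ->
  exists N (v : X -> set N), [/\ compact_omega_model T N, adm N X v &
    forall phi, p phi -> sat phi v].
Proof.
move=> [M [v [MT av pv]]].
pose K (n : nat) : predicate L X := fun M v =>
  [/\ is_model T M, adm M X v & forall phi, p phi -> sat phi v].
have [n M' v' []|n M' v'|n|N [v0 [Nc av0 truth _]]] :=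
  @generic_model X K X [set FBot] _ _ _ (@no_omission X K) => //.
  by exists M, v.
exists N, v0; split=> // phi pphi; apply: truth.
by exists 0 => M' v' [_ _]; apply.
Qed.

(** Suppose a condition has no extension omitting [p] at [h]. Then its realizations satisfy all of
    [p] at [h], and the formula saying that a co-valuation is fragmented along [h] by one with the
    property [cpred] isolates [p]. *)
Lemma compact_omission (X : context) (p : set (formula L X)) :
  (exists M, is_model T M) -> ~ isolated T p ->
  exists2 N, compact_omega_model T N &
    forall v : X -> set N, adm N X v -> exists2 psi, p psi & ~ sat psi v.
Proof.
move=> [M0 M0T] niso.
pose K (n : nat) : predicate L star := fun M v => is_model T M /\ adm M star v.
suff dense c (h : X -> set (cctx c)) : consistent K c -> cobijective h ->
    exists d (ge : cctx c -> set (cctx d)),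
      [/\ consistent K d, extends ge & omitted K p (rcomp h ge)].
  have [|||N [v0 [Nc _ _ om]]] := @generic_model star K X p _ _ _ dense => //.
    by move=> n; have [_ [v av] _] := M0T; exists M0, v.
  by exists N.
have Kdec n M (v : star -> set M) : K n.+1 M v -> K n M v by [].
have KS n M (v : star -> set M) : K n M v -> is_structure M /\ adm M star v.
  by case=> [[]].
move=> con ch; apply: contrapT => ndense; apply: niso.
have all psi : p psi -> forall M (u : cctx c -> set M), realizes K 0 u ->
    sat psi (rcomp h u).
  move=> ppsi M u ru.
  have [[n nP]|[d [ge [cd ege f]]]] := forces_decide KS Kdec con ch
      (definable_sat (FNeg psi)).
    by apply: contrapT; exact: nP.
  by case: ndense; exists d, ge; split=> //; exists psi.
have [cr dp real] := con.
have [phi phiP] := definable_exfr ch dp.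
have [M [u ru]] := real 0; have [au [MT _] pu] := ru; have [MS _ _] := MT.
exists phi.
  exists M, (rcomp h u); split=> //; first exact: adm_rcomp.
  by move=> _ ->; apply/(phiP _ MS); [exact: adm_rcomp | exists u].
move=> M' v' M'T av'; have [M'S _ _] := M'T => /(phiP _ M'S _ av').
move=> [w [aw -> pw]] psi ppsi; apply: all => //.
by split=> //; split=> //; exact: adm_rcomp.
Qed.

(** [K n] excludes the types isolated by the first [n] formulas. With infinitely many types no [K n]
    is empty, and the resulting compact model realizes a type whose isolating formula was excluded
    at some stage. *)
Lemma isolated_finite (X : context) :
  (forall p : set (formula L X), types T p -> isolated T p) ->
  finite_set (@types L T X).
Proof.
move=> iso; apply: contrapT => inf.
have /countable_injP [cL cL_inj] := L_countable.
have {}cL_inj : injective cL by move=> R R'; apply: cL_inj; rewrite in_setE.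
have [c c_inj] := formula_coding cL_inj.
pose c' (phi : formula L X) := c (existT _ X phi).
have c'_inj : injective c'.
  by move=> phi psi /c_inj /(@eq_from_Tagged _ _ _ phi psi).
have [e eP] := infinitely_often FBot c'_inj.
pose isolates (phi : formula L X) (p : set (formula L X)) :=
  [/\ types T p, realized T [set phi] & forall M (v : X -> set M),
    is_model T M -> adm M X v -> sat phi v -> forall psi, p psi -> sat psi v].
pose K n : predicate L X := fun M v => [/\ is_model T M, adm M X v &
  forall m, (m < n)%N -> (exists p, isolates (e m) p) -> ~ sat (e m) v].
have Kne n : exists M (v : X -> set M), K n M v.
  (* If [K n] is empty, each type is isolated by one of the first [n] formulas, and a formula
     isolates at most one type. *)
  apply: contrapT => Kn; apply: inf.
  have /ex_choice [g gP] m : exists q, (exists p, isolates (e m) p) ->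
      isolates (e m) q.
    have [[q qP]|h] := pselect (exists p, isolates (e m) p); first by exists q.
    by exists set0 => /h.
  apply: (@sub_finite_set _ _ [set g m | m in [set: 'I_n]]); last first.
    exact/finite_image/finite_finset.
  move=> p tp; have [M [v [MT av ev]]] := types_realized tp.
  have [m [mn [q qP] sm]] : exists m, [/\ (m < n)%N,
      exists p, isolates (e m) p & sat (e m) v].
    apply: contrapT => h; apply: Kn; exists M, v; split=> // m mn ex sm.
    by apply: h; exists m.
  exists (Ordinal mn) => //=.
  have [tg rg ig] := gP m (ex_intro _ q qP).
  by rewrite ev; apply/(isolated_type_of tg rg ig).
have [n M' v' []|n M' v' [MT av h]||N [v0 [[NT _ _] av0 truth _]]] :=
  @generic_model X K X [set FBot] _ _ _ (@no_omission X K) => //.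
  by split=> // m mn; apply: h; exact: ltnW.
have tv0 := type_of_types NT av0.
have [phi rphi iphi] := iso _ tv0.
have [m _ em] := eP phi 0.
have s0 : sat phi v0 by apply/(isolated_type_of tv0 rphi iphi).
have /= := truth (FNeg phi); apply; last exact: s0.
exists m.+1 => M v [_ _ /(_ m (ltnSn m))]; rewrite em => h /=.
by apply: h; exists (type_of v0).
Qed.

End Types.

(** * Isomorphisms *)

Section Isomorphism.
Variables (L : signature).
Implicit Types M N : protoStructure L.

Lemma isomorphic_adm M N (f : M -> N) :
  (forall X : context,
     [set (fun x : X => f @` u x) | u in adm M X] = adm N X) ->
  forall (X : context) (w : X -> set N),
    adm N X w <-> exists2 u, adm M X u & w = (fun x => f @` u x).
Proof.
by move=> E X w; rewrite -E; split=> [[u au <-]|[u au ->]]; exists u.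
Qed.

Lemma isomorphic_sat M N (f : M -> N) : bijective f ->
  (forall (R : L) (a : 'I_(arity R) -> M),
     interp M R a <-> interp N R (fun k => f (a k))) ->
  (forall X : context,
     [set (fun x : X => f @` u x) | u in adm M X] = adm N X) ->
  forall (X : context) (phi : formula L X) (v : X -> set M),
    sat phi v <-> sat phi (fun x => f @` v x).
Proof.
move=> [g fK gK] fR fV X phi.
have im_inj (Y : context) (u u' : Y -> set M) :
    (fun y => f @` u y) = (fun y => f @` u' y) -> u = u'.
  move=> E; apply/funext => y; have := congr1 (fun w => w y) E => /= Ey.
  by apply/seteqP; split=> a ua; have : (f @` u y) (f a) by
    [exists a | rewrite Ey; exists a]; [rewrite Ey|]; case=> b ub /(can_inj fK) <-.
have im_comp (Y Z : context) (r : Y -> set Z) (u : Z -> set M) :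
    (fun y => f @` rcomp r u y) = rcomp r (fun z => f @` u z).
  apply/funext => y; apply/seteqP; split=> b.
    by case=> a [z rz uz] <-; exists z => //; exists a.
  by case=> z rz [a uz <-]; exists a => //; exists z.
elim: phi => {X} [X|X R x|X phi IH|X phi IHphi psi IHpsi|X Y r cr phi IH] v /=.
- by [].
- split=> [[a va Ra]|[b vb Rb]].
    by exists (fun k => f (a k)); [move=> k; exists (a k) | apply/fR].
  exists (fun k => g (b k)) => [k|].
    by have [a va <-] := vb k; rewrite fK.
  apply/fR; congr (interp N R _): Rb.
  by apply/funext => k; rewrite gK.
- by rewrite IH.
- by rewrite IHphi IHpsi.
- split=> [[w [aw -> sw]]|[w [aw e sw]]].
    exists (fun z => f @` w z); split; last exact/IH.
      by apply/(isomorphic_adm fV); exists w.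
    exact: im_comp.
  have [u au eu] := (isomorphic_adm fV w).1 aw; exists u; split=> //.
    by apply: im_inj; rewrite e eu im_comp.
  by apply/IH; rewrite -eu.
Qed.

End Isomorphism.

Lemma closed_coordinatewise (S : topologicalType) (I : Type)
    (C : set (prod_topology (fun _ : I => S))) (b : nat -> I -> S) (a : I -> S) :
  closed C -> (forall n, C (b n)) ->
  (forall i, (fun n => b n i) @ \oo --> a i) -> C a.
Proof.
move=> cl Cb ba.
apply: (@closed_cvg _ (prod_topology (fun _ : I => S)) \oo _ b C cl).
  exact: nearW.
apply/cvg_sup => i; rewrite cvg_image; last first.
  by rewrite eqEsubset; split=> v // _; exists (fun _ => v).
move=> W /= Wa; exists ((fun f : I -> S => f i) @^-1` W); first exact: ba.
by rewrite image_preimage // eqEsubset; split=> // j _; exists (fun _ => j).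
Qed.

(** * Recovering a compact structure from a cofinal tower *)

Section Towers.
Variables (L : signature) (X : nat -> context).
Variable ge : forall n, X n -> set (X n.+1).
Implicit Types M N : protoStructure L.

Definition coval_tower M (v : forall n, X n -> set M) : Prop :=
  [/\ forall n, adm M (X n) (v n),
      forall n, v n = rcomp (ge (n:=n)) (v n.+1) &
      forall (Y : context) (u : Y -> set M), adm M Y u ->
        exists n, is_consolidation u (v n)].

Lemma coval_tower_down M v : @coval_tower M v ->
  forall m n, (m <= n)%N -> v m = rcomp (@dn X ge m n) (v n).
Proof.
by move=> [_ vE _] m n; exact: (@down_covaluation (levels X) ge M v).
Qed.

(** Inclusion between members is decided by [ge] alone: both are moved to a common level, where the
    co-valuation cancels. So it agrees in all structures over the same tower. *)
Lemma coval_tower_sub M N v w : @coval_tower M v -> @coval_tower N w ->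
  forall m n (x : X m) (y : X n), w n y `<=` w m x -> v n y `<=` v m x.
Proof.
move=> tv tw m n x y sub a.
have mk := leq_maxl m n; have nk := leq_maxr m n.
have [av _ _] := tv; have [aw _ _] := tw.
move: sub; rewrite (coval_tower_down tw mk) (coval_tower_down tw nk).
rewrite (coval_tower_down tv mk) (coval_tower_down tv nk) => sub.
case=> z yz vz; exists z => //.
exact: (rcomp_sub (adm_cobijective (aw (maxn m n))) sub).
Qed.

Lemma coval_tower_refines M v (tau : Topological M) :
  @coval_tower M v ->
  (forall U : set (set (Topological.Pack tau)), is_open_cover U ->
     exists (Y : context) (u : Y -> set M), adm M Y u /\
       forall y, exists2 A, U A & u y `<=` A) ->
  forall U : set (set (Topological.Pack tau)), is_open_cover U ->
    exists n, forall x, exists2 A, U A & v n x `<=` A.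
Proof.
move=> [av _ vcof] ref U /ref [Y [u [au uU]]].
have [n [h ch eu]] := vcof _ _ au; exists n => x.
have [y hyx] := ch.1 x; have [A UA uA] := uU y; exists A => //.
by move=> a va; apply: uA; rewrite eu; exists x.
Qed.

(** A level is chosen that refines the cover by [U] and the complement of [a], open by T1; a member
    containing [a] cannot lie in the complement. *)
Lemma coval_tower_base M v (tau : Topological M) :
  @coval_tower M v -> accessible_space (Topological.Pack tau) ->
  (forall U : set (set (Topological.Pack tau)), is_open_cover U ->
     exists (Y : context) (u : Y -> set M), adm M Y u /\
       forall y, exists2 A, U A & u y `<=` A) ->
  forall (U : set (Topological.Pack tau)) (a : M), open U -> U a ->
    exists n, forall x, v n x a -> v n x `<=` U.
Proof.
move=> tv acc ref U a oU Ua.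
have [|n nP] := coval_tower_refines tv ref (U := [set U; ~` [set a]]).
  split=> [A [->//|->]|].
    by apply: closed_openC; exact: accessible_closed_set1.
  apply/seteqP; split=> // b _.
  have [->|ba] := pselect (b = a); first by exists U => //; left.
  by exists (~` [set a]); [right | move=> /= /ba].
exists n => x vxa; have [A [->//|-> sub]] := nP x.
by have := sub _ vxa; case.
Qed.

Lemma coval_tower_later M v : @coval_tower M v ->
  forall m n, (m <= n)%N -> forall (U : set M) (a : M),
  (forall x, v m x a -> v m x `<=` U) -> forall y, v n y a -> v n y `<=` U.
Proof.
move=> tv m n mn U a mU y vya.
have [av _ _] := tv; have E := coval_tower_down tv mn.
have [x xy] : exists x, @dn X ge m n x y.
  have : cobijective (@dn X ge m n).
    apply: (@cobij_left _ _ _ _ (v n)); last exact: adm_cobijective.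
    by rewrite -E; exact: adm_cobijective.
  by move=> [h _]; exact: h.
move=> b vyb; apply: (mU x); rewrite E; by exists y.
Qed.

Lemma coval_tower_separated M v : has_compact_topology M -> @coval_tower M v ->
  forall a b : M, (forall n x, v n x a -> v n x b) -> a = b.
Proof.
move=> [tau [_ acc _ ref _]] tv a b ab; apply: contrapT => neq.
have [||n nP] := coval_tower_base tv acc ref (U := ~` [set b]) (a := a).
- by apply: closed_openC; exact: accessible_closed_set1.
- by [].
have [av _ _] := tv.
have [x vxa] := (adm_cobijective (av n)).1 a.
by have := nP x vxa b (ab _ _ vxa); case.
Qed.

(** Tuples of the relation that share a box of level [n] with [a] converge to [a] as [n] grows, and
    the relation is closed. *)
Lemma coval_tower_interp M v : has_compact_topology M -> @coval_tower M v ->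
  forall (R : L) (a : 'I_(arity R) -> M),
  (interp M R a <-> forall n (x : 'I_(arity R) -> X n),
     (forall k, v n (x k) (a k)) -> sat (FRel R x) (v n)).
Proof.
move=> [tau [_ acc _ ref cl]] tv R a.
have [av _ _] := tv.
split=> [Ra n x xa|H]; first by exists a.
have /ex_choice [b bP] n : exists b : 'I_(arity R) -> M, interp M R b /\
    exists x : 'I_(arity R) -> X n, forall k, v n (x k) (a k) /\ v n (x k) (b k).
  have /ex_choice [x xP] k : exists x, v n x (a k).
    exact: (adm_cobijective (av n)).1.
  have [b xb Rb] := H n x xP; exists b; split=> //.
  by exists x => k.
apply: (@closed_coordinatewise (Topological.Pack tau) _ _ b a (cl R)).
  by move=> n; exact: (bP n).1.
move=> k W; rewrite nbhsE => -[U [oU Ua] UW].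
have [n nP] := coval_tower_base tv acc ref oU Ua.
exists n => // m /= nm; apply: UW.
have [_ [x xP]] := bP m; have [xa xb] := xP k.
exact: (coval_tower_later tv nm nP xa).
Qed.

(** If no [b] works, the members [w m x] with [a] outside [v m x] cover [N]. A level refines this
    cover, and its inclusions carry over to [M], where some member of the level contains [a]. *)
Lemma coval_tower_match M N v w :
  has_compact_topology N -> @coval_tower M v -> @coval_tower N w ->
  forall a : M, exists b : N, forall n x, w n x b -> v n x a.
Proof.
move=> [tau [_ _ op ref _]] tv tw a; apply: contrapT => /forallNP h.
have [av _ _] := tv; have [aw _ _] := tw.
have [|n nP] := coval_tower_refines tw ref
    (U := [set A | exists m x, A = w m x /\ ~ v m x a]).
  split=> [_ [m [x [-> _]]]|].
    by apply: (op _ _ (aw m)).1; exists x.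
  apply/seteqP; split=> // b _; apply: contrapT => nb; apply: (h b) => m x wb.
  by apply: contrapT => nv; apply: nb; exists (w m x) => //; exists m, x.
have [y vya] := (adm_cobijective (av n)).1 a.
have [_ [m [x [-> nvx]]] sub] := nP y.
by apply: nvx; exact: (coval_tower_sub tv tw sub) vya.
Qed.

Lemma coval_tower_isomorphic M N v w :
  has_compact_topology M -> has_compact_topology N ->
  @coval_tower M v -> @coval_tower N w ->
  (forall n (R : L) (x : 'I_(arity R) -> X n),
     sat (FRel R x) (v n) <-> sat (FRel R x) (w n)) ->
  isomorphic M N.
Proof.
move=> tM tN tv tw eqR.
have matched M' N' v' w' : has_compact_topology M' -> has_compact_topology N' ->
    @coval_tower M' v' -> @coval_tower N' w' ->
    forall a : M', exists b : N', forall n x, v' n x a <-> w' n x b.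
  move=> tM' tN' tv' tw' a.
  have [b ab] := coval_tower_match tN' tv' tw' a.
  have [a' ba'] := coval_tower_match tM' tw' tv' b.
  (* Matching gives only one inclusion between the members around [a] and [b]; matching back yields
     [a'], and separation forces [a' = a]. *)
  have ea : a' = a.
    by apply: (coval_tower_separated tM' tv') => n x /ba' /ab.
  by exists b => n x; split=> [|/ab//]; rewrite -ea; exact: ba'.
have /ex_choice [f fP] := matched _ _ _ _ tM tN tv tw.
have /ex_choice [g gP] := matched _ _ _ _ tN tM tw tv.
have fK : cancel f g.
  move=> a; apply: (coval_tower_separated tM tv) => n x.
  by move=> /gP /fP.
have gK : cancel g f.
  move=> b; apply: (coval_tower_separated tN tw) => n x.
  by move=> /fP /gP.
have fv n x : f @` v n x = w n x.
  apply/seteqP; split=> [_ [a va <-]|b wb]; first exact/fP.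
  by exists (g b); [exact/gP | exact: gK].
have [av _ vcof] := tv; have [aw _ wcof] := tw.
have fh (Y : context) n (h : Y -> set (X n)) :
    (fun y => f @` rcomp h (v n) y) = rcomp h (w n).
  apply/funext => y; apply/seteqP; split=> [_ [a [x hx va] <-]|b [x hx]].
    by exists x => //; rewrite -fv; exists a.
  by rewrite -fv => -[a va <-]; exists a => //; exists x.
exists f; split; first by exists g.
- move=> R a; rewrite (coval_tower_interp tM tv) (coval_tower_interp tN tw).
  split=> H n x xa; [apply/eqR | apply/eqR]; apply: H => k.
    exact/fP.
  exact/fP.
- move=> Y; apply/seteqP; split=> [_ [u au <-]|u au].
    have [n [h ch ->]] := vcof _ _ au.
    by rewrite /= fh; exact: adm_rcomp.
  have [n [h ch ->]] := wcof _ _ au.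
  by exists (rcomp h (v n)); [exact: adm_rcomp | exact: fh].
Qed.

End Towers.

(** * Back-and-forth between compact models *)

Section BackAndForth.
Variables (L : signature) (T : set (sentence L)).
Implicit Types M N : protoStructure L.
Hypothesis types_isolated : forall (X : context) (p : set (formula L X)),
  types T p -> isolated T p.

Definition same_type M N (X : context) (v : X -> set M) (w : X -> set N) :=
  forall phi : formula L X, sat phi v <-> sat phi w.

(** The formula [chi] isolating the type of [v'] makes the whole type transferable: its
    quantification along [ge] is one formula true at [v], hence at [w]. *)
Lemma same_type_extend M N (X Z : context) (v : X -> set M) (w : X -> set N)
    (ge : X -> set Z) (v' : Z -> set M) :
  is_model T M -> is_model T N -> adm N X w -> same_type v w ->
  cobijective ge -> adm M Z v' -> v = rcomp ge v' ->
  exists w', [/\ adm N Z w', w = rcomp ge w' & same_type v' w'].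
Proof.
move=> MT NT aw vw cge av' ev.
have tv' := type_of_types MT av'.
have [chi rchi ichi] := types_isolated tv'.
have sv' : sat chi v' by apply/(isolated_type_of tv' rchi ichi).
have [w' [aw' ew sw']] : sat (FExFr cge chi) w by apply/vw; exists v'.
exists w'; split=> // phi.
have e : type_of v' = type_of w' by apply/(isolated_type_of tv' rchi ichi).
have -> : sat phi v' = type_of v' phi by [].
by rewrite e.
Qed.

Lemma same_type_sym M N (X : context) (v : X -> set M) (w : X -> set N) :
  same_type v w -> same_type w v.
Proof. by move=> vw phi; split=> /vw. Qed.

Lemma same_type_forth M N (X Y : context) (v : X -> set M) (w : X -> set N)
    (u : Y -> set M) :
  is_model T M -> is_model T N -> adm M X v -> adm N X w -> same_type v w ->
  adm M Y u ->
  exists (Z : context) (ge : X -> set Z) (v' : Z -> set M) (w' : Z -> set N),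
    [/\ cobijective ge, adm M Z v' /\ adm N Z w', v = rcomp ge v' /\ w = rcomp ge w',
     same_type v' w' & is_consolidation u v'].
Proof.
move=> MT NT av aw vw au; have [MS _ _] := MT.
have [Z [v' [av' [ge cge ev] uv']]] := MS.1 _ _ _ _ av au.
have [w' [aw' ew vw']] := same_type_extend MT NT aw vw cge av' ev.
by exists Z, ge, v', w'.
Qed.

Record matching M N := Matching {
  mctx : context;
  mleft : mctx -> set M;
  mright : mctx -> set N;
  mleft_adm : adm M mctx mleft;
  mright_adm : adm N mctx mright;
  matching_type : same_type mleft mright }.

Lemma consolidation_trans (A : Type) (X Y Z : context) (u : X -> set A)
    (v : Y -> set A) (w : Z -> set A) :
  is_consolidation u v -> is_consolidation v w -> is_consolidation u w.
Proof.
move=> [r cr ->] [s cs ->]; exists (rcomp r s); first exact: cobij_comp.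
by rewrite rcompA.
Qed.

Lemma matching_step M N (Y Y' : context) (u : Y -> set M) (t : Y' -> set N)
    (s : matching M N) :
  is_model T M -> is_model T N -> adm M Y u -> adm N Y' t ->
  exists q : {s' : matching M N & mctx s -> set (mctx s')},
    [/\ @mleft _ _ s = rcomp (projT2 q) (@mleft _ _ (projT1 q)),
        @mright _ _ s = rcomp (projT2 q) (@mright _ _ (projT1 q)),
        is_consolidation u (@mleft _ _ (projT1 q)) &
        is_consolidation t (@mright _ _ (projT1 q))].
Proof.
move=> MT NT au ta; case: s => X v w av aw vw /=.
have [Z [ge [v1 [w1 [cge [av1 aw1] [ev ew] vw1 uv1]]]]] :=
  same_type_forth MT NT av aw vw au.
have [Z' [ge' [w2 [v2 [cge' [aw2 av2] [ew1 ev1] vw2 tw2]]]]] :=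
  same_type_forth NT MT aw1 av1 (same_type_sym vw1) ta.
exists (existT (fun s' => X -> set (mctx s'))
  (Matching av2 aw2 (same_type_sym vw2)) (rcomp ge ge')) => /=.
split=> //; rewrite ?rcompA -?ev1 -?ew1 //.
by apply: (consolidation_trans uv1); exists ge'.
Qed.

(** Completeness of [T] is what starts the back-and-forth, since context [*] admits only the total
    co-valuation. *)
Lemma same_type_star M N (v : star -> set M) (w : star -> set N) :
  complete_theory T -> is_model T M -> is_model T N ->
  adm M star v -> adm N star w -> same_type v w.
Proof.
move=> [_ comp] MT NT av aw phi.
have E M' (v' : star -> set M') (psi : sentence L) : adm M' star v' ->
    sat_sentence M' psi -> sat psi v'.
  by move=> av' [u au su]; rewrite (adm_star av') -(adm_star au).
have [all|all] := comp phi; first by split=> _; apply: E => //; exact: all.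
by split=> s; [have := E _ _ _ av (all _ MT) | have := E _ _ _ aw (all _ NT)].
Qed.

Theorem compact_models_isomorphic M N : complete_theory T ->
  compact_omega_model T M -> compact_omega_model T N -> isomorphic M N.
Proof.
move=> compT [MT Mtop [Y [u [au uc ucof]]]] [NT Ntop [Y' [t [ta tc tcof]]]].
have [_ [v0 av0] _] := MT; have [_ [w0 aw0] _] := NT.
pose s0 := Matching av0 aw0 (same_type_star compT MT NT av0 aw0).
(* Stage [n.+1] absorbs the [n]-th members of both given sequences, which makes the tower cofinal on
   both sides. *)
pose next n (s : matching M N) := cid (matching_step s MT NT (au n) (ta n)).
pose fix s n : matching M N :=
  if n is n'.+1 then projT1 (sval (next n' (s n'))) else s0.
pose ge n : mctx (s n) -> set (mctx (s n.+1)) := projT2 (sval (next n (s n))).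
have geP n : [/\ @mleft _ _ (s n) = rcomp (ge n) (@mleft _ _ (s n.+1)),
    @mright _ _ (s n) = rcomp (ge n) (@mright _ _ (s n.+1)),
    is_consolidation (u n) (@mleft _ _ (s n.+1)) &
    is_consolidation (t n) (@mright _ _ (s n.+1))].
  exact: proj2_sig (next n (s n)).
apply: (@coval_tower_isomorphic L (fun n => mctx (s n)) ge M N
  (fun n => @mleft _ _ (s n)) (fun n => @mright _ _ (s n))) => //.
- split=> [n|n|Z z az]; first exact: mleft_adm.
    by have [] := geP n.
  have [n zn] := ucof _ _ az; exists n.+1; apply: consolidation_trans zn _.
  by have [] := geP n.
- split=> [n|n|Z z az]; first exact: mright_adm.
    by have [] := geP n.
  have [n zn] := tcof _ _ az; exists n.+1; apply: consolidation_trans zn _.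
  by have [] := geP n.
- by move=> n R x; exact: (@matching_type _ _ (s n) (FRel R x)).
Qed.

End BackAndForth.

(** * Renaming of contexts and the equivalences *)

Lemma renaming (X Y : context) : #|` X| = #|` Y| ->
  exists (r : Y -> set X) (r' : X -> set Y), [/\ cobijective r, cobijective r',
    rcomp r r' = @rid Y & rcomp r' r = @rid X].
Proof.
move=> e; have eXY : #|{: X}| = #|{: Y}| by rewrite -!cardfE.
pose f (y : Y) : X := enum_val (cast_ord (esym eXY) (enum_rank y)).
pose g (x : X) : Y := enum_val (cast_ord eXY (enum_rank x)).
have fK : cancel f g.
  by move=> y; rewrite /f /g enum_valK cast_ordKV enum_rankK.
have gK : cancel g f.
  by move=> x; rewrite /f /g enum_valK cast_ordK enum_rankK.
exists (fun y x => f y = x), (fun x y => f y = x); split.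
- split=> [x|y]; first by exists (g x).
  by exists (f y); split=> // y' /(can_inj fK).
- split=> [y|x]; first by exists (f y).
  by exists (g x); split=> // x' <-.
- apply/funext => y; apply/seteqP; split=> y'.
    by case=> x <- /(can_inj fK).
  by move=> <-; exists (f y).
- apply/funext => x; apply/seteqP; split=> x'.
    by case=> y <-.
  by move=> <-; exists (g x).
Qed.

(** The theorem fixes one context for each size, while the back-and-forth meets arbitrary ones. A
    bijective renaming is co-bijective, so quantifying along it carries the isolating formula
    over. *)
Lemma isolated_renaming (L : signature) (T : set (sentence L)) (X Y : context) :
  #|` X| = #|` Y| ->
  (forall p : set (formula L X), types T p -> isolated T p) ->
  forall p : set (formula L Y), types T p -> isolated T p.
Proof.
move=> /renaming [r [r' [cr cr' rr' r'r]]] iso p tp.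
have [M [v [MT av ep]]] := types_realized tp; have [MS _ _] := MT.
pose v' := rcomp r' v.
have av' : adm M X v' by exact: adm_rcomp.
have tv' := type_of_types MT av'.
have [chi rchi ichi] := iso _ tv'.
have schi : sat chi v' by apply/(isolated_type_of tv' rchi ichi).
exists (FExFr cr chi).
  exists M, v; split=> // _ ->; exists v'; split=> //.
  by rewrite -rcompA rr' rcomp_idl.
move=> N w NT aw /= [w' [aw' -> sw']] psi; rewrite ep => psiv.
have [NS _ _] := NT.
have [phi phiP] := definable_subst cr (definable_sat psi).
apply/(phiP N NS w' aw'); apply: (ichi _ _ NT aw' sw').
apply/(phiP M MS v' av'); rewrite -rcompA rr' rcomp_idl; exact: psiv.
Qed.

(** A type that is not isolated would be realized in one compact model and omitted in another, while
    isomorphisms preserve truth. *)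
Lemma omega_categorical_isolated (L : signature) (T : set (sentence L))
    (X : context) : countable [set: L] ->
  omega_categorical T -> forall p : set (formula L X), types T p -> isolated T p.
Proof.
move=> cL [M Mc Muniq] p tp; apply: contrapT => niso.
have [N [v [Nc av pv]]] := compact_realization cL tp.2.
have [MT _ _] := Mc.
have [N' Nc' om] := compact_omission cL (ex_intro _ M MT) niso.
have [f [fb fR fV]] := Muniq _ Nc; have [g [gb gR gV]] := Muniq _ Nc'.
have [u au ev] := (isomorphic_adm fV v).1 av.
have aw : adm N' X (fun x => g @` u x) by apply/(isomorphic_adm gV); exists u.
have [psi ppsi []] := om _ aw.
apply/(isomorphic_sat gb gR gV)/(isomorphic_sat fb fR fV).
by rewrite -ev; exact: pv.
Qed.

Lemma isolated_omega_categorical (L : signature) (T : set (sentence L)) :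
  countable [set: L] -> complete_theory T ->
  (forall (X : context) (p : set (formula L X)), types T p -> isolated T p) ->
  omega_categorical T.
Proof.
move=> cL compT iso; have [[M MT] _] := compT.
have [_ [v av] _] := MT.
(* Realizing the empty set of formulas yields some compact model to start from. *)
have [|N [_ [Nc _ _]]] := @compact_realization L T cL star set0.
  by exists M, v.
exists N => // N' Nc'; exact: (compact_models_isomorphic iso compT Nc Nc').
Qed.

Local Open Scope fset_scope.

Theorem mainTheorem7 (L : signature) (T : set (sentence L))
    (X : nat -> context)
    (L_countable : countable [set: L])
    (T_complete : complete_theory T)
    (size_X : forall n : nat, #|` X n| = n) :
  (omega_categorical T <->
     (forall (n : nat) (p : set (formula L (X n))),
        types T p -> isolated T p)) /\
  ((forall (n : nat) (p : set (formula L (X n))),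
      types T p -> isolated T p) <->
     (forall n : nat, finite_set (@types L T (X n)))).
Proof.
split; split.
- by move=> cat n; exact: omega_categorical_isolated.
- move=> iso; apply: isolated_omega_categorical => // Y.
  by apply: (isolated_renaming (X := X #|` Y|)); [exact: size_X | exact: iso].
- by move=> iso n; apply: isolated_finite => //; exact: iso.
- by move=> fin n; exact: finite_isolated.
Qed.
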